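(* Let $(K,|\cdot|)$ be a non-archimedean local field with ring of integers $\mathcal{O}_K$, let $e\ge 2$ be an integer that is invertible in $\mathcal{O}_K$, and let $\phi\in K(x)$ be a rational function that can be written as $\phi=f_1/f_2$ with $f_1,f_2\in\mathcal{O}_K[x]$ monic and $\deg f_1-\deg f_2=e$. Let $b_\phi\in x+\mathcal{O}_K[[1/x]]$ be the Böttcher coordinate of $\phi$. Let $\alpha\in K$ with $|\alpha|>1$. (1) Let $\gamma\in K$ be such that $|\gamma|>1$. The map $b_\phi$ induces an isomorphism of $G_K$-sets $$\{\beta\in K^{\mathrm{sep}}: |\beta|>1,\ \phi(\beta)=\gamma\}\to\{\beta\in K^{\mathrm{sep}}: \beta^e=b_\phi(\gamma)\}.$$ (2) The subset of vertices $$T_\infty^e(\phi,\alpha)=T_\infty(\phi,\alpha)\cap\{\beta\in K^{\mathrm{sep}}: |\beta|>1\},$$ with the induced graph structure, is a regular tree of degree $e$ rooted at $\alpha$ (every vertex has exactly $e$ descendants at the next level). Furthermore, this tree is preserved by $G_K$. (3) $b_\phi$ induces an isomorphism of $G_K$-trees $$T_\infty^e(\phi,\alpha)\to T_\infty(x^e,b_\phi(\alpha))$$ and yields an equality of fields $K(T_\infty^e(\phi,\alpha))=K(T_\infty(x^e,b_\phi(\alpha)))$.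
   Context: A non-archimedean local field is a finite extension of $\mathbb{Q}_p$ or a field isomorphic to $\mathbb{F}_q((T))$ with $q$ a power of a prime $p$, with its standard absolute value. Fix a separable closure $K^{\mathrm{sep}}$, let $G_K=\mathrm{Gal}(K^{\mathrm{sep}}/K)$, and extend $|\cdot|$ uniquely to $K^{\mathrm{sep}}$. The function $\phi$ is viewed, by geometric expansion, as an element of $x^e(1+\frac1x\mathcal{O}_K[[1/x]])$. The Böttcher coordinate $b_\phi$ is the unique element of $x+\mathcal{O}_K[[1/x]]$ such that $b_\phi\circ\phi=b_\phi^{\,e}$; it converges on $\{\gamma\in K^{\mathrm{sep}}:|\gamma|>1\}$ and defines a $G_K$-equivariant bijection of this set to itself. For a rational map $h$ over $K$ and $a\in K$, $T_\infty(h,a)$ is the rooted tree of iterated preimages of $a$ under $h$: the root is $a$, the vertices at level $n$ are the solutions of $h^n(x)=a$, and a vertex $\beta$ at level $n+1$ is joined to $h(\beta)$ at level $n$ (its unique ascendant; $\beta$ is called a descendant of $h(\beta)$). $K(T)$ denotes the field generated over $K$ by the vertices of $T$. A morphism of $G_K$-trees is a $G_K$-equivariant tree morphism. *)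

(* Defs.v *)
From HB Require Import structures.
From mathcomp Require Import all_boot all_order all_algebra separable.
From mathcomp Require Import all_classical all_reals.

Set Implicit Arguments.
Unset Strict Implicit.
Unset Printing Implicit Defensive.

Import Order.TTheory GRing.Theory Num.Theory.
Local Open Scope classical_set_scope.
Local Open Scope ring_scope.

Section AbsoluteValues.
Variables (R : realType) (F : fieldType) (abs : F -> R).

Definition nonarch_absval : Prop :=
  [/\ forall x, 0 <= abs x,
      forall x, abs x = 0 <-> x = 0,
      forall x y, abs (x * y) = abs x * abs y &
      forall x y, abs (x + y) <= Num.max (abs x) (abs y)].

Definition abs_cvg (u : nat -> F) (l : F) : Prop :=
  forall eps : R, 0 < eps ->
    exists N : nat, forall n : nat, (N <= n)%N -> abs (u n - l) < eps.

Definition abs_cauchy (u : nat -> F) : Prop :=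
  forall eps : R, 0 < eps ->
    exists N : nat, forall m n : nat, (N <= m)%N -> (N <= n)%N ->
      abs (u m - u n) < eps.

Definition abs_complete : Prop :=
  forall u : nat -> F, abs_cauchy u -> exists l : F, abs_cvg u l.

Definition integer_ring : {pred F} := [pred x | abs x <= 1].

End AbsoluteValues.

(* [a : int -> A] stands for the formal series with coefficient [a n] at
   t ^ n.  The sums over infinite index sets below have only finitely many
   nonzero terms when the arguments are Laurent series. *)

Section Laurent.
Variable A : fieldType.

Definition laurent (a : int -> A) : Prop :=
  exists m : int, forall n : int, n < m -> a n = 0.

Definition laurent_one : int -> A := fun n => (n == 0)%:R.

Definition laurent_mul (a b : int -> A) : int -> A :=
  fun n => \sum_(i \in [set: int]) a i * b (n - i).

Definition laurent_exp (a : int -> A) (k : nat) : int -> A :=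
  iter k (laurent_mul a) laurent_one.

(* A polynomial in x, as a Laurent series in t = 1/x. *)
Definition laurent_of_poly (p : {poly A}) : int -> A :=
  fun n => if n <= 0 then p`_(`|n|%N) else 0.

End Laurent.

(* The number c in ]0, 1[ is |p| (resp. |T|): its value is left free so
   that every normalisation of the standard absolute value is covered. *)

Section LocalFields.
Variable R : realType.

Definition padic_val (p : nat) (q : rat) : int :=
  (logn p `|numq q|%N)%:Z - (logn p `|denq q|%N)%:Z.

Definition padic_abs (c : R) (p : nat) (q : rat) : R :=
  if q == 0 then 0 else c ^ padic_val p q.

(* F is Q_p: the completion of the rationals for the p-adic absolute
   value. *)
Definition is_Qp (c : R) (p : nat) (F : fieldType) (abs : F -> R) : Prop :=
  [/\ nonarch_absval abs,
      forall q : rat, abs (ratr q) = padic_abs c p q,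
      abs_complete abs &
      forall (x : F) (eps : R), 0 < eps ->
        exists q : rat, abs (x - ratr q) < eps].

Definition finite_extension (F K : fieldType) (j : {rmorphism F -> K}) : Prop :=
  exists (d : nat) (s : 'I_d -> K), forall x : K,
    exists a : 'I_d -> F, x = \sum_(i < d) j (a i) * s i.

Definition padic_local_field (K : fieldType) (abs : K -> R) : Prop :=
  exists (p : nat) (c : R) (F : fieldType) (absF : F -> R)
         (j : {rmorphism F -> K}),
    [/\ prime p /\ 0 < c < 1, is_Qp c p absF, finite_extension j,
        nonarch_absval abs & forall x : F, abs (j x) = absF x].

(* coef is an isomorphism of fields from K to k((T)). *)
Definition laurent_isomorphism (K k : fieldType) (coef : K -> int -> k) : Prop :=
  [/\ set_bij [set: K] [set a | laurent a] coef,
      coef 1 = @laurent_one k,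
      forall (x y : K) (n : int), coef (x + y) n = coef x n + coef y n &
      forall x y : K, coef (x * y) = laurent_mul (coef x) (coef y)].

Definition laurent_local_field (K : fieldType) (abs : K -> R) : Prop :=
  exists (k : finFieldType) (c : R) (coef : K -> int -> k),
    [/\ 0 < c < 1, laurent_isomorphism coef, nonarch_absval abs &
        forall (x : K) (n : int),
          coef x n != 0 -> (forall m : int, m < n -> coef x m = 0) ->
          abs x = c ^ n].

Definition local_field (K : fieldType) (abs : K -> R) : Prop :=
  padic_local_field abs \/ laurent_local_field abs.

End LocalFields.

Section Galois.
Variables (K L : fieldType) (iota : {rmorphism K -> L}).

Definition separable_over (y : L) : Prop :=
  exists2 p : {poly K}, separable_poly p & root (map_poly iota p) y.

Definition separably_closed : Prop :=
  forall p : {poly L}, separable_poly p -> (1 < size p)%N ->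
    exists y : L, root p y.

Definition separable_closure : Prop :=
  (forall y : L, separable_over y) /\ separably_closed.

Definition galois_aut (s : {rmorphism L -> L}) : Prop :=
  bijective s /\ forall x : K, s (iota x) = iota x.

Definition intermediate_field (M : set L) : Prop :=
  [/\ forall x : K, M (iota x),
      forall x y : L, M x -> M y -> M (x - y),
      forall x y : L, M x -> M y -> M (x * y) &
      forall x : L, M x -> M x^-1].

Definition generated_field (S : set L) : set L :=
  smallest intermediate_field S.

(* Isomorphism between two subsets A and B on which the Galois group
   acts, the action on the ambient type being given by act. *)
Definition galois_set_iso (W : Type) (act : {rmorphism L -> L} -> W -> W)
    (A B : set W) (f : W -> W) : Prop :=
  [/\ forall s, galois_aut s -> act s @` A = A,
      forall s, galois_aut s -> act s @` B = B,
      set_bij A B f &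
      forall s, galois_aut s -> forall w, A w -> f (act s w) = act s (f w)].

(* The self-map of the projective line over L (None is the point at
   infinity) given by a rational function over K.  The numerator and
   denominator of the chosen representative of h need not be coprime. *)
Definition ratfun_map (h : {fraction {poly K}}) (z : option L) : option L :=
  let g := gcdp (\n_(repr h)) (\d_(repr h)) in
  let p := map_poly iota (\n_(repr h) %/ g) in
  let q := map_poly iota (\d_(repr h) %/ g) in
  match z with
  | Some y => if q.[y] == 0 then None else Some (p.[y] / q.[y])
  | None => if (size q < size p)%N then None
            else Some (p`_(size q).-1 / lead_coef q)
  end.

End Galois.

(* A graph is a set V of vertices together with a symmetric adjacency
   relation, implicitly restricted to V. *)

Section Trees.
Variable W : eqType.

(* V is nonempty and any two vertices are joined by exactly one path
   without repeated vertices. *)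
Definition is_tree (V : set W) (adj : W -> W -> Prop) : Prop :=
  V !=set0 /\
  forall u v : W, V u -> V v ->
    exists! p : seq W,
      [/\ path (fun x y => `[< V y /\ adj x y >]) u p,
          last u p = v & uniq (u :: p)].

Definition descendants (level : W -> nat) (V : set W)
    (adj : W -> W -> Prop) (v : W) : set W :=
  [set w | [/\ V w, adj v w & level w = (level v).+1]].

Definition regular_rooted_tree (level : W -> nat) (e : nat) (V : set W)
    (adj : W -> W -> Prop) (r : W) : Prop :=
  [/\ V r, level r = 0%N, is_tree V adj &
      forall v : W, V v -> (descendants level V adj v #= `I_e)%card].

End Trees.

(* Vertices are pairs (n, y), where n is the level: a point y may a priori
   be an n-th preimage of a for several values of n. *)
Section PreimageTree.
Variables (K L : fieldType) (iota : {rmorphism K -> L}).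

Definition T_infty (h : {fraction {poly K}}) (a : K) : set (nat * L) :=
  [set v | iter v.1 (ratfun_map iota h) (Some v.2) = Some (iota a)].

Definition ascends (h : {fraction {poly K}}) (w v : nat * L) : Prop :=
  w.1 = v.1.+1 /\ ratfun_map iota h (Some w.2) = Some v.2.

Definition T_adj (h : {fraction {poly K}}) (v w : nat * L) : Prop :=
  ascends h v w \/ ascends h w v.

Definition T_act (s : {rmorphism L -> L}) (v : nat * L) : nat * L :=
  (v.1, s v.2).

Definition vertex_points (V : set (nat * L)) : set L := snd @` V.

Definition galois_tree_iso (V1 : set (nat * L)) (adj1 : nat * L -> nat * L -> Prop)
    (r1 : nat * L) (V2 : set (nat * L)) (adj2 : nat * L -> nat * L -> Prop)
    (r2 : nat * L) (f : nat * L -> nat * L) : Prop :=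
  [/\ galois_set_iso iota T_act V1 V2 f,
      f r1 = r2,
      forall v, V1 v -> (f v).1 = v.1 &
      forall v w, V1 v -> V1 w -> (adj1 v w <-> adj2 (f v) (f w))].

Variables (R : realType) (absL : L -> R).

Definition T_infty_e (h : {fraction {poly K}}) (a : K) : set (nat * L) :=
  T_infty h a `&` [set v | 1 < absL v.2].

End PreimageTree.

(* The sequence b encodes the series x + b_0 + b_1 / x + b_2 / x ^ 2 + .... *)

Section Boettcher.
Variables (R : realType) (K : fieldType) (abs : K -> R).

(* As a Laurent series in 1/x. *)
Definition boettcher_series (b : nat -> K) : int -> K :=
  fun n => match n with
           | Posz k => b k
           | Negz k => (k == 0%N)%:R
           end.

(* Composition of this series with Phi, Psi being the inverse of Phi. *)
Definition boettcher_comp (b : nat -> K) (Phi Psi : int -> K) : int -> K :=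
  fun n => Phi n + \sum_(k \in [set: nat]) b k * laurent_exp Psi k n.

Definition is_boettcher (f1 f2 : {poly K}) (e : nat) (b : nat -> K) : Prop :=
  (forall k, b k \in integer_ring abs) /\
  exists Phi Psi : int -> K,
    [/\ laurent Phi /\ laurent Psi,
        laurent_mul Phi (laurent_of_poly f2) = laurent_of_poly f1,
        laurent_mul Psi Phi = @laurent_one K &
        boettcher_comp b Phi Psi = laurent_exp (boettcher_series b) e].

(* Value at z of the series, in an extension F of K with absolute value
   absF; it is 0 when the series does not converge. *)
Definition boettcher_eval (F : fieldType) (absF : F -> R) (iota : K -> F)
    (b : nat -> K) (z : F) : F :=
  xget 0 [set y | abs_cvg absF
    (fun N => z + \sum_(0 <= k < N) iota (b k) * z ^- k) y].

End Boettcher.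

(* Main.v *)
Require Import Defs.
From HB Require Import structures.
From mathcomp Require Import all_boot all_order all_algebra separable.
From mathcomp Require Import all_classical all_reals ring zify generic_quotient.

(** Outside the closed unit disc the series b(z) = z + b_0 + b_1 / z + ... is an
    isometric bijection which conjugates phi to the power map x ^ e, so everything
    said about preimages under phi there can be read off from e-th roots.

    Isometry and injectivity.  The tail b(z) - z has integral coefficients in
    1 / z, so it contracts distances strictly where |z| > 1
    (boettcher_tail_contraction); by the ultrametric inequality
    |b(z) - b(w)| = |z - w| (boettcher_isometry).

    Surjectivity and fields of definition.  L need not be complete, but every
    y in L is algebraic over K, and K(y) = K[y] is a finite-dimensional normed
    space over the complete field K, hence complete (adjoin_complete).  So b(z)
    lies in K(z), and the contraction z |-> w - (b(z) - z) has a fixed point in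
    K(w), which solves b(z) = w (boettcher_surj).  This gives K(z) = K(b(z)), and
    with it the equality of the fields generated by the two trees, without any
    Galois correspondence.

    Equivariance.  An absolute value on K has at most one extension to L
    (absval_extension_unique), so Galois automorphisms are isometries and commute
    with limits of series over K (boettcher_galois).

    Conjugation.  The identity b o phi = b ^ e between formal Laurent series in
    1/x becomes b(phi(z)) = b(z) ^ e once evaluation of Laurent series with
    integral coefficients is known to respect products and the substitution
    defining the composite (laurent_valueM, laurent_value_comp); integrality of
    the expansion of phi = f1 / f2 comes from f2 being monic
    (laurent_quotient_integral).

    Hence b maps the preimages of gamma under phi outside the disc bijectively
    onto the e-th roots of b(gamma) (outer_preimages_bij): a root w of
    x ^ e = b(gamma) is b(z) for some z, and b(phi(z)) = b(gamma) forces
    phi(z) = gamma.  As e is invertible and L is separably closed there are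
    exactly e roots.  Iterating gives the isomorphism of trees; that the vertices
    do form a tree holds for any levelled set with a parent map
    (levelled_is_tree). *)

Set Implicit Arguments.
Unset Strict Implicit.
Unset Printing Implicit Defensive.

Import Order.TTheory GRing.Theory Num.Theory.
Local Open Scope classical_set_scope.
Local Open Scope ring_scope.

(** * Non-archimedean absolute values *)

Section AbsoluteValueTheory.
Variables (R : realType) (F : fieldType) (abs : F -> R).
Hypothesis absP : nonarch_absval abs.

Lemma abs_ge0 x : 0 <= abs x. Proof. by case: absP. Qed.

Lemma abs_eq0 x : abs x = 0 <-> x = 0. Proof. by case: absP. Qed.

Lemma absM : {morph abs : x y / x * y}. Proof. by case: absP. Qed.

Lemma abs0 : abs 0 = 0. Proof. by apply/abs_eq0. Qed.

Lemma abs_gt0 x : x != 0 -> 0 < abs x.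
Proof.
move=> x0; rewrite lt_neqAle abs_ge0 andbT eq_sym.
by apply: contra x0 => /eqP/abs_eq0 ->.
Qed.

Lemma abs1 : abs 1 = 1.
Proof.
have h : abs 1 != 0 by rewrite gt_eqF // abs_gt0 // oner_eq0.
by apply: (mulfI h); rewrite -absM !mulr1.
Qed.

Lemma absX x n : abs (x ^+ n) = abs x ^+ n.
Proof. by elim: n => [|n IH]; rewrite ?expr0 ?abs1 // !exprS absM IH. Qed.

Lemma absN x : abs (- x) = abs x.
Proof.
have h : abs (-1) = 1.
  apply/eqP; rewrite -(@eqrXn2 _ 2) ?abs_ge0 //.
  by rewrite -absX sqrrN !expr1n abs1.
by rewrite -mulN1r absM h mul1r.
Qed.

Lemma absV x : abs x^-1 = (abs x)^-1.
Proof.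
have [->|x0] := eqVneq x 0; first by rewrite invr0 abs0 invr0.
have h : abs x != 0 by rewrite gt_eqF ?abs_gt0.
by apply: (mulfI h); rewrite -absM !divff // abs1.
Qed.

Lemma absD_le x y c : abs x <= c -> abs y <= c -> abs (x + y) <= c.
Proof.
by case: absP => _ _ _ h hx hy; apply: le_trans (h _ _) _; rewrite ge_max hx.
Qed.

Lemma absB_le x y c : abs x <= c -> abs y <= c -> abs (x - y) <= c.
Proof. by move=> hx hy; apply: absD_le; rewrite ?absN. Qed.

Lemma absD_lt x y c : abs x < c -> abs y < c -> abs (x + y) < c.
Proof.
by case: absP => _ _ _ h hx hy; apply: le_lt_trans (h _ _) _; rewrite gt_max hx.
Qed.

Lemma abs_distC x y : abs (x - y) = abs (y - x).
Proof. by rewrite -opprB absN. Qed.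

Lemma abs_dist_lt x y z c : abs (x - y) < c -> abs (y - z) < c -> abs (x - z) < c.
Proof. by move=> hx hy; rewrite -(subrKA y); apply: absD_lt. Qed.

Lemma abs_dist_le x y z c :
  abs (x - y) <= c -> abs (y - z) <= c -> abs (x - z) <= c.
Proof. by move=> hx hy; rewrite -(subrKA y); apply: absD_le. Qed.

Lemma abs_sum_le (I : Type) (r : seq I) (P : pred I) (f : I -> F) c :
  0 <= c -> (forall i, P i -> abs (f i) <= c) -> abs (\sum_(i <- r | P i) f i) <= c.
Proof.
move=> c0 hf; elim/big_ind: _ => //; first by rewrite abs0.
by move=> x y; apply: absD_le.
Qed.

(** The isosceles triangle principle. *)
Lemma absD_dominant x y : abs y < abs x -> abs (x + y) = abs x.
Proof.
move=> h; apply/le_anti/andP; split; first exact: absD_le (ltW h).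
rewrite leNgt; apply/negP => hlt.
have := @absD_lt (x + y) (- y) _ hlt; rewrite absN => /(_ h).
by rewrite addrK ltxx.
Qed.

Lemma abs_cvg_unique (u : nat -> F) (l l' : F) :
  abs_cvg abs u l -> abs_cvg abs u l' -> l = l'.
Proof.
move=> hl hl'; apply/eqP; rewrite -subr_eq0; apply/negPn/negP => /abs_gt0 h.
have [N hN] := hl _ h; have [N' hN'] := hl' _ h.
have h1 := hN (maxn N N') (leq_maxl _ _); have h2 := hN' (maxn N N') (leq_maxr _ _).
rewrite abs_distC in h1; have := abs_dist_lt h1 h2.
by rewrite ltxx.
Qed.

(** Completeness is needed for subsets of a field that need not itself be complete,
    such as the finite subextensions of a separable closure. *)
Definition complete_in (M : set F) : Prop :=
  forall u : nat -> F, (forall n, M (u n)) -> abs_cauchy abs u ->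
    exists2 l, M l & abs_cvg abs u l.

Lemma abs_cvg_cauchy (u : nat -> F) l : abs_cvg abs u l -> abs_cauchy abs u.
Proof.
move=> ul eps /ul[N hN]; exists N => m n hm hn.
by apply: (@abs_dist_lt _ l); rewrite ?hN // abs_distC hN.
Qed.

Lemma abs_cvg_le (u : nat -> F) l c :
  abs_cvg abs u l -> (forall n, abs (u n) <= c) -> abs l <= c.
Proof.
move=> ul uc; rewrite leNgt; apply/negP => hc.
have l0 : 0 < abs l by apply: le_lt_trans (hc); apply: le_trans (uc 0%N); apply: abs_ge0.
have [N /(_ N (leqnn N)) hN] := ul _ l0.
have : abs l = abs (u N).
  rewrite -[in RHS](subrK l (u N)) addrC absD_dominant //.
by move: hc => /[swap] -> ; rewrite ltNge uc.
Qed.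

End AbsoluteValueTheory.

Lemma bernoulli (R : realDomainType) (h : R) n : 0 <= h -> 1 + h *+ n <= (1 + h) ^+ n.
Proof.
move=> h0; elim: n => [|n IH]; first by rewrite mulr0n addr0 expr0.
have h1 : 0 <= 1 + h by rewrite addr_ge0.
rewrite exprS; apply: le_trans (ler_wpM2l h1 IH).
rewrite mulrSr -subr_ge0.
rewrite (_ : _ - _ = h * (h *+ n)); first by rewrite mulr_ge0 // mulrn_wge0.
by rewrite -mulr_natl; ring.
Qed.

Lemma exists_expr_lt (R : archiRealFieldType) (r eps : R) :
  0 <= r < 1 -> 0 < eps -> exists N, forall n, (N <= n)%N -> r ^+ n < eps.
Proof.
move=> /andP[r0 r1] e0.
suff [N hN] : exists N, r ^+ N < eps.
  exists N => n Nn; apply: le_lt_trans hN.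
  by rewrite -(subnK Nn) exprD ler_piMl ?exprn_ge0 // exprn_ile1 // ltW.
have [->|rn0] := eqVneq r 0; first by exists 1%N; rewrite expr1.
have rp : 0 < r by rewrite lt_neqAle eq_sym rn0.
(* With 1 / r = 1 + h, Bernoulli's inequality makes (1 / r) ^ N exceed 1 / eps. *)
pose h := r^-1 - 1.
have h0 : 0 < h by rewrite subr_gt0 invf_gt1.
have [N hN] : exists N, eps^-1 / h < N%:R.
  by exists (Num.bound (eps^-1 / h)); apply: archi_boundP; rewrite divr_ge0 ?invr_ge0 ?ltW.
exists N; rewrite -[r]invrK exprVn invf_plt ?posrE ?exprn_gt0 ?invr_gt0 //.
rewrite (_ : r^-1 = 1 + h); last by rewrite /h addrC subrK.
apply: lt_le_trans (bernoulli _ (ltW h0)).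
rewrite ltr_pdivrMr // in hN; apply: lt_le_trans hN _.
by rewrite mulr_natl lerDr.
Qed.

(** * Finite extensions of complete fields *)

Lemma half_exp_gt0 (R : realFieldType) n : 0 < (2^-1 : R) ^+ n.
Proof. by rewrite exprn_gt0 // invr_gt0. Qed.

Section FiniteExtension.
Variables (R : realType) (K L : fieldType) (iota : {rmorphism K -> L}).
Variables (abs : K -> R) (absL : L -> R).
Hypotheses (absP : nonarch_absval abs) (absLP : nonarch_absval absL).
Hypothesis absLK : forall x : K, absL (iota x) = abs x.
Hypothesis Kcomplete : abs_complete abs.

(** Defined by recursion on the generators, with no independence required, so that
    one can add generators one at a time and treat a redundant one separately. *)
Fixpoint lin_span (s : seq L) : set L :=
  if s is e :: s' then [set x | exists a v, lin_span s' v /\ x = iota a * e + v]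
  else [set 0].

Lemma lin_spanD s x y : lin_span s x -> lin_span s y -> lin_span s (x + y).
Proof.
elim: s x y => [|e s IH] x y /=; first by move=> -> ->; rewrite addr0.
move=> [a [v [hv ->]]] [b [w [hw ->]]]; exists (a + b), (v + w); split; first exact: IH.
by rewrite rmorphD; ring.
Qed.

Lemma lin_spanZ s a x : lin_span s x -> lin_span s (iota a * x).
Proof.
elim: s x => [|e s IH] x /=; first by move=> ->; rewrite mulr0.
move=> [b [w [hw ->]]]; exists (a * b), (iota a * w); split; first exact: IH.
by rewrite rmorphM; ring.
Qed.

Lemma lin_spanN s x : lin_span s x -> lin_span s (- x).
Proof. by move=> /(lin_spanZ (-1)); rewrite rmorphN1 mulN1r. Qed.

Lemma lin_spanB s x y : lin_span s x -> lin_span s y -> lin_span s (x - y).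
Proof. by move=> hx /lin_spanN; apply: lin_spanD. Qed.

(** If no such d existed, elements of the span would approach - e, and
    completeness would put e in the span. *)
Lemma lin_span_dist s e : complete_in absL (lin_span s) -> ~ lin_span s e ->
  exists2 d : R, 0 < d &
    forall a v, lin_span s v -> abs a * d <= absL (iota a * e + v).
Proof.
move=> sc se.
have [d d0 hd] : exists2 d : R, 0 < d & forall v, lin_span s v -> d <= absL (e + v).
  apply: contrapT => hn.
  have /choice[u hu] : forall n : nat, exists v, lin_span s v /\ absL (e + v) < 2^-1 ^+ n.
    move=> n; apply: contrapT => hv; apply: hn; exists (2^-1 ^+ n).
      exact: half_exp_gt0.
    move=> v sv; rewrite leNgt; apply/negP => h; apply: hv.
    by exists v.
  have ucvg : abs_cvg absL u (- e).
    move=> eps e0; have [|N hN] := @exists_expr_lt _ (2^-1 : R) eps _ e0.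
      by rewrite invr_ge0 ler0n invf_lt1 // ltr1n.
    exists N => n /hN; rewrite opprK addrC; apply: lt_trans; exact: (hu n).2.
  have [l sl ul] := sc u (fun n => (hu n).1) (abs_cvg_cauchy absLP ucvg).
  apply: se; rewrite -(opprK e) (abs_cvg_unique absLP ucvg ul).
  exact: lin_spanN.
exists d => // a v sv.
have [->|a0] := eqVneq a 0; first by rewrite (abs0 absP) mul0r abs_ge0.
have ia0 : iota a != 0 by rewrite fmorph_eq0.
rewrite (_ : _ + v = iota a * (e + iota a^-1 * v)); last first.
  by rewrite mulrDr fmorphV mulVKf.
rewrite absM // absLK ler_wpM2l ?abs_ge0 //; apply: hd; exact: lin_spanZ.
Qed.

(** Adding a generator e outside a complete span keeps it complete: by
    lin_span_dist the e-coordinate depends continuously on the vector, so the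
    coordinates of a Cauchy sequence are Cauchy separately. *)
Lemma lin_span_complete s : complete_in absL (lin_span s).
Proof.
elim: s => [|e s IH] u us uc /=.
  exists 0 => // eps e0; exists 0%N => n _.
  by rewrite (us n) subr0 abs0.
have [se|se] := pselect (lin_span s e).
  have [|l sl ul] := IH u _ uc.
    by move=> n; have [a [v [sv ->]]] := us n; apply: lin_spanD; first exact: lin_spanZ.
  by exists l => //; exists 0, l; rewrite rmorph0 mul0r add0r.
have [d d0 hd] := lin_span_dist IH se.
have /choice[av hav] : forall n, exists av : K * L,
    lin_span s av.2 /\ u n = iota av.1 * e + av.2.
  by move=> n; have [a [v h]] := us n; exists (a, v).
have uB m n : u m - u n = iota ((av m).1 - (av n).1) * e + ((av m).2 - (av n).2).
  by rewrite !(hav _).2 rmorphB; ring.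
have sB m n : lin_span s ((av m).2 - (av n).2).
  by apply: lin_spanB; apply: (hav _).1.
have [a ha] : exists a, abs_cvg abs (fun n => (av n).1) a.
  apply: Kcomplete => eps e0; have [N hN] := uc _ (mulr_gt0 e0 d0).
  exists N => m n hm hn; rewrite -(ltr_pM2r d0).
  by apply: le_lt_trans (hN m n hm hn); rewrite uB; apply: hd.
pose e1 := absL e + 1.
have e1p : 0 < e1 by rewrite ltr_wpDl // abs_ge0.
have aecvg : abs_cvg absL (fun n => iota (av n).1 * e) (iota a * e).
  move=> eps e0; have [N hN] := ha _ (divr_gt0 e0 e1p); exists N => n /hN.
  rewrite ltr_pdivlMr // -mulrBl -rmorphB absM // absLK; apply: le_lt_trans.
  by rewrite ler_wpM2l ?abs_ge0 // lerDl.
have [v sv vcvg] : exists2 v, lin_span s v & abs_cvg absL (fun n => (av n).2) v.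
  apply: IH; first by move=> n; apply: (hav n).1.
  move=> eps e0; have [N hN] := uc _ e0.
  have [N' hN'] := abs_cvg_cauchy absLP aecvg e0.
  exists (maxn N N') => m n; rewrite !geq_max => /andP[hm hm'] /andP[hn hn'].
  rewrite (_ : _ - _ = (u m - u n) - (iota (av m).1 * e - iota (av n).1 * e)); last first.
    by rewrite uB rmorphB; ring.
  by apply: absD_lt; rewrite ?absN // ?hN // hN'.
exists (iota a * e + v); first by exists a, v.
move=> eps e0; have [N hN] := aecvg _ e0; have [N' hN'] := vcvg _ e0.
exists (maxn N N') => n; rewrite geq_max => /andP[hn hn'].
rewrite (hav n).2 opprD addrACA; apply: absD_lt => //; [exact: hN|exact: hN'].
Qed.
End FiniteExtension.

Section ExtensionUniqueness.
Variables (R : realType) (K L : fieldType) (iota : {rmorphism K -> L}).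
Variables (abs : K -> R) (absP : nonarch_absval abs) (Kcomplete : abs_complete abs).
Variables (abs1 abs2 : L -> R).
Hypotheses (abs1P : nonarch_absval abs1) (abs2P : nonarch_absval abs2).
Hypothesis abs1K : forall x : K, abs1 (iota x) = abs x.
Hypothesis abs2K : forall x : K, abs2 (iota x) = abs x.

(** One half of the equivalence of norms on a finite-dimensional space. *)
Lemma lin_span_bounded s :
  exists2 C : R, 0 < C & forall x, lin_span iota s x -> abs1 x <= C * abs2 x.
Proof.
elim: s => [|e s [C C0 hC]].
  by exists 1 => // x ->; rewrite (abs0 abs1P) mul1r abs_ge0.
have [se|se] := pselect (lin_span iota s e).
  exists C => // x /= [a [v [sv ->]]]; apply: hC; apply: lin_spanD => //.
  exact: lin_spanZ.
have sc : complete_in abs2 (lin_span iota s) by apply: (lin_span_complete absP).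
have [d d0 hd] := lin_span_dist absP abs2P abs2K sc se.
pose A1 := abs1 e; pose A2 := abs2 e; pose D := d^-1.
have D0 : 0 < D by rewrite invr_gt0.
have [A10 A20] : 0 <= A1 /\ 0 <= A2 by rewrite !abs_ge0.
(* By lin_span_dist the coefficient a is at most D * abs2 (a e + v); this bounds
   the terms a e and v separately. *)
exists (D * A1 + C + C * (D * A2)) => [|x /= [a [v [sv ->]]]].
  apply: ltr_wpDr; first by rewrite !mulr_ge0 // ltW.
  by apply: ltr_wpDl => //; rewrite mulr_ge0 // ltW.
set X := abs2 _.
have X0 : 0 <= X by rewrite abs_ge0.
have ha : abs a <= D * X by rewrite mulrC ler_pdivlMr //; apply: hd.
have hv1 : abs2 v <= X + D * X * A2.
  rewrite (_ : v = (iota a * e + v) - iota a * e); last by rewrite addrC addKr.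
  apply: absB_le => //; first by rewrite lerDl !mulr_ge0 // ltW.
  rewrite absM // abs2K; apply: le_trans (ler_wpM2r A20 ha) _.
  by rewrite lerDr.
have t1 : 0 <= D * A1 * X by rewrite !mulr_ge0 // ltW.
have t2 : 0 <= C * (X + D * X * A2).
  by rewrite mulr_ge0 ?addr_ge0 ?mulr_ge0 // ltW.
rewrite (_ : _ * X = D * A1 * X + C * (X + D * X * A2)); last by ring.
apply: absD_le => //.
  rewrite absM // abs1K; apply: (@le_trans _ _ (D * X * A1)).
    by rewrite ler_wpM2r // abs_ge0.
  by rewrite mulrAC lerDl.
apply: le_trans (hC v sv) _; apply: (@le_trans _ _ (C * (X + D * X * A2))).
  by rewrite ler_wpM2l // ltW.
by rewrite lerDr.
Qed.

End ExtensionUniqueness.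

Section Adjoin.
Variables (K L : fieldType) (iota : {rmorphism K -> L}).

(** The ring K[y]; it is the field K(y) when the extension is algebraic
    (adjoin_field). *)
Definition adjoin (y : L) : set L :=
  [set x | exists p : {poly K}, x = (map_poly iota p).[y]].

Lemma adjoin_id y : adjoin y y.
Proof. by exists 'X; rewrite map_polyX hornerX. Qed.

Lemma adjoinC y a : adjoin y (iota a).
Proof. by exists a%:P; rewrite map_polyC hornerC. Qed.

Lemma adjoinB y u v : adjoin y u -> adjoin y v -> adjoin y (u - v).
Proof. by move=> [p ->] [q ->]; exists (p - q); rewrite rmorphB hornerE hornerN. Qed.

Lemma adjoinM y u v : adjoin y u -> adjoin y v -> adjoin y (u * v).
Proof. by move=> [p ->] [q ->]; exists (p * q); rewrite rmorphM hornerM. Qed.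

Lemma adjoinX y u n : adjoin y u -> adjoin y (u ^+ n).
Proof. by move=> [p ->]; exists (p ^+ n); rewrite rmorphXn horner_exp. Qed.

Lemma adjoin_trans x y u : adjoin y x -> adjoin x u -> adjoin y u.
Proof.
move=> [p ->] [q ->]; exists (q \Po p).
by rewrite map_comp_poly horner_comp.
Qed.

Hypothesis algebraicL : forall x : L,
  exists2 q : {poly K}, q != 0 & root (map_poly iota q) x.

(** A polynomial relation c + x * q(x) = 0 with c nonzero gives 1 / x = - q(x) / c;
    a relation without constant term can be divided by x. *)
Lemma adjoinV_self x : adjoin x x^-1.
Proof.
have [->|x0] := eqVneq x 0; first by rewrite invr0; exact: adjoin_id.
have [q] := algebraicL x; elim/poly_ind: q => [|q c IH]; first by rewrite eqxx.
move=> qc0; rewrite rmorphD rmorphM /= map_polyX map_polyC /= rootE !hornerE.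
have [c0|c0] := eqVneq c 0.
  rewrite c0 rmorph0 addr0 mulf_eq0 (negPf x0) orbF; apply: IH.
  by apply: contraNneq qc0 => ->; rewrite c0 mul0r addr0.
move=> /eqP h; exists (- (c^-1 *: q)).
rewrite rmorphN /= map_polyZ hornerN hornerZ /=.
apply: (mulIf x0); rewrite mulVf // mulNr -mulrA.
have -> : (map_poly iota q).[x] * x = - iota c by apply/eqP; rewrite -addr_eq0 h.
by rewrite mulrN opprK -rmorphM mulVf // rmorph1.
Qed.

Lemma adjoin_field y : intermediate_field iota (adjoin y).
Proof.
split; [exact: adjoinC|exact: adjoinB|exact: adjoinM|].
by move=> x yx; apply: adjoin_trans yx (adjoinV_self x).
Qed.

Lemma adjoin_sub (M : set L) y : intermediate_field iota M -> M y -> adjoin y `<=` M.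
Proof.
move=> [MK MB MM _] My x [p ->].
elim/poly_ind: p => [|p c IH].
  by rewrite rmorph0 horner0 -(rmorph0 iota); apply: MK.
rewrite rmorphD rmorphM /= map_polyX map_polyC /= !hornerE.
have M0 : M 0 by rewrite -(rmorph0 iota); apply: MK.
rewrite -[iota c]opprK; apply: (MB); first exact: MM.
by rewrite -sub0r; apply: MB.
Qed.

(** Euclidean division by a polynomial that vanishes at y shows that finitely many
    powers of y suffice. *)
Lemma adjoin_lin_span y : exists s, adjoin y = lin_span iota s.
Proof.
have [q q0 qy] := algebraicL y.
(* In decreasing order, so that the power list grows at its head, as lin_span does. *)
pose pw n := rev (mkseq (fun i => y ^+ i) n).
have pwS n : pw n.+1 = y ^+ n :: pw n by rewrite /pw mkseqS rev_rcons.
exists (pw (size q).-1); apply/seteqP; split => x.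
  move=> [p ->]; rewrite {1}(divp_eq p q) rmorphD rmorphM /= hornerD hornerM.
  rewrite (rootP qy) mulr0 add0r.
  have : (size (p %% q)%R <= (size q).-1)%N.
    by rewrite -ltnS prednK ?size_poly_gt0 // ltn_modp.
  move: (p %% q) (size q).-1 => r n hr.
  rewrite (@horner_coef_wide _ n) ?size_map_poly //.
  under eq_bigr do rewrite coef_map.
  elim: n {hr} => [|n IH] /=; first by rewrite big_ord0.
  rewrite pwS big_ord_recr /=; exists r`_n, (\sum_(i < n) iota r`_i * y ^+ i).
  by rewrite addrC.
elim: (size q).-1 x => [|n IH] x /=.
  by move=> ->; exists 0; rewrite rmorph0 horner0.
rewrite pwS /= => -[a [v [/IH[p ->] ->]]]; exists (a *: 'X^n + p).
by rewrite rmorphD /= map_polyZ /= map_polyXn !hornerE.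
Qed.

End Adjoin.

Section AbsoluteValueAlgebraic.
Variables (R : realType) (K L : fieldType) (iota : {rmorphism K -> L}).
Variables (abs : K -> R) (absP : nonarch_absval abs) (Kcomplete : abs_complete abs).
Hypothesis algebraicL : forall x : L,
  exists2 q : {poly K}, q != 0 & root (map_poly iota q) x.

Lemma adjoin_complete (absL : L -> R) y : nonarch_absval absL ->
  (forall x : K, absL (iota x) = abs x) -> complete_in absL (adjoin iota y).
Proof.
move=> absLP absLK; have [s ->] := adjoin_lin_span algebraicL y.
exact: (lin_span_complete absP).
Qed.

(** The powers of y stay in a finite-dimensional space, where the two absolute
    values are comparable up to a constant C; comparing the values of y ^ n for all
    n removes the constant. *)
Lemma absval_extension_unique (abs1 abs2 : L -> R) :
  nonarch_absval abs1 -> nonarch_absval abs2 ->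
  (forall x : K, abs1 (iota x) = abs x) -> (forall x : K, abs2 (iota x) = abs x) ->
  abs1 =1 abs2.
Proof.
suff le_ext (a1 a2 : L -> R) : nonarch_absval a1 -> nonarch_absval a2 ->
    (forall x : K, a1 (iota x) = abs x) -> (forall x : K, a2 (iota x) = abs x) ->
    forall y, a1 y <= a2 y.
  by move=> h1 h2 k1 k2 y; apply/le_anti; rewrite !le_ext.
move=> h1 h2 k1 k2 y; rewrite leNgt; apply/negP => lt21.
have [s sE] := adjoin_lin_span algebraicL y.
have [C C0 hC] := lin_span_bounded absP Kcomplete h1 h2 k1 k2 s.
have p1 : 0 < a1 y by apply: le_lt_trans lt21; apply: abs_ge0.
have [||N /(_ N (leqnn N))] := @exists_expr_lt _ (a2 y / a1 y) C^-1.
- by rewrite divr_ge0 ?abs_ge0 // ltr_pdivrMr // mul1r.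
- by rewrite invr_gt0.
rewrite expr_div_n ltr_pdivrMr ?exprn_gt0 // ltr_pdivlMl //.
rewrite -!absX // ltNge hC // -sE; exact/adjoinX/adjoin_id.
Qed.

End AbsoluteValueAlgebraic.

(** * Completeness of local fields *)

Section LocalFieldsComplete.
Variables (R : realType) (K : fieldType) (abs : K -> R).

Lemma padic_local_field_complete : padic_local_field abs -> abs_complete abs.
Proof.
move=> [p [c [F [absF [j [_ [absFP _ Fc _] [d [s hs]] absP absE]]]]]].
have [t tT] : exists t, lin_span j t = [set: K].
  suff [t ht] : exists t, forall a : 'I_d -> F, lin_span j t (\sum_(i < d) j (a i) * s i).
    exists t; apply/seteqP; split => // x _; have [a ->] := hs x; exact: ht.
  elim: d s {hs} => [|d IH] s.
    by exists [::] => a; rewrite big_ord0.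
  have [t ht] := IH (fun i => s (lift ord0 i)).
  exists (s ord0 :: t) => a; rewrite big_ord_recl /=.
  by exists (a ord0), (\sum_(i < d) j (a (lift ord0 i)) * s (lift ord0 i)).
move=> u uc; have tc : complete_in abs (lin_span j t) by apply: (lin_span_complete absFP).
by rewrite tT in tc; have [l _ ul] := tc u (fun=> I) uc; exists l.
Qed.

End LocalFieldsComplete.

Lemma laurent_order (A : fieldType) (a : int -> A) n : laurent a -> a n != 0 ->
  exists2 l : int, l <= n & a l != 0 /\ forall m : int, m < l -> a m = 0.
Proof.
move=> [m am] an.
have mE i : m <= i -> m + `|i - m|%N%:Z = i by lia.
have mn : m <= n by rewrite leNgt; apply: contraNN an => /am ->.
have ex : exists k : nat, a (m + k%:Z) != 0.
  by exists `|n - m|%N; rewrite mE.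
case: (ex_minnP ex) => k ak kmin; exists (m + k%:Z).
  have := kmin `|n - m|%N; rewrite mE // => /(_ an).
  lia.
split=> // i ik; apply: contraTeq isT => ai.
have mi : m <= i by rewrite leNgt; apply: contraNN ai => /am ->.
have := kmin `|i - m|%N; rewrite mE // => /(_ ai).
lia.
Qed.

Section LaurentField.
Variables (R : realType) (K : fieldType) (abs : K -> R).
Variables (k : finFieldType) (c : R) (coef : K -> int -> k).
Hypotheses (c01 : 0 < c < 1) (coefP : laurent_isomorphism coef).
Hypothesis absP : nonarch_absval abs.
Hypothesis abs_coef : forall (x : K) (n : int), coef x n != 0 ->
  (forall m : int, m < n -> coef x m = 0) -> abs x = c ^ n.

Lemma laurent_coefD x y n : coef (x + y) n = coef x n + coef y n.
Proof. by case: coefP. Qed.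

Lemma laurent_coef0 n : coef 0 n = 0.
Proof. by apply: (addrI (coef 0 n)); rewrite -laurent_coefD !addr0. Qed.

Lemma laurent_coefB x y n : coef (x - y) n = coef x n - coef y n.
Proof. by apply/eqP; rewrite eq_sym subr_eq -laurent_coefD subrK. Qed.

Lemma laurent_coefP x : laurent (coef x).
Proof. by case: coefP => -[h _ _] _ _ _; apply: h. Qed.

Lemma exprz_mono_lt1 (m n : int) : (c ^ m <= c ^ n) = (n <= m).
Proof.
case/andP: c01 => c0 c1; have cp (i : int) : 0 < c ^ i by rewrite exprz_gt0.
case: (leP n m) => [nm|mn].
  have -> : m = n + `|m - n|%N%:Z by lia.
  by rewrite expfzDr ?gt_eqF // ler_piMr ?exprn_ile1 ?ltW // cp.
have -> : n = m + `|n - m|.-1.+1%:Z by lia.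
by rewrite expfzDr ?gt_eqF // leNgt gtr_pMr // exprn_ilt1 ?ltW.
Qed.

Lemma abs_laurent_le x (n : int) :
  (forall m : int, m < n -> coef x m = 0) -> abs x <= c ^ n.
Proof.
move=> xn; case/andP: c01 => c0 _.
have [->|x0] := eqVneq x 0; first by rewrite abs0 // exprz_ge0 // ltW.
have [m xm] : exists m, coef x m != 0.
  apply: contrapT => h; move/eqP: x0; apply.
  case: coefP => -[_ inj _] _ _ _; apply: inj; rewrite ?inE //.
  apply/funext => m; rewrite laurent_coef0; apply/eqP/negPn/negP => hm.
  by apply: h; exists m.
have [l lm [xl xlt]] := laurent_order (laurent_coefP x) xm.
rewrite (abs_coef xl xlt) exprz_mono_lt1 leNgt; apply/negP => /xn xl0.
by rewrite xl0 eqxx in xl.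
Qed.

(** A small absolute value forces the low coefficients to vanish, so that each
    coefficient of a Cauchy sequence is eventually constant. *)
Lemma coef_small_abs x (n m : int) : abs x < c ^ n -> m <= n -> coef x m = 0.
Proof.
move=> xn mn; apply/eqP/negPn/negP => xm.
have [l lm [xl xlt]] := laurent_order (laurent_coefP x) xm.
by move: xn; rewrite (abs_coef xl xlt) ltNge exprz_mono_lt1 (le_trans lm).
Qed.

(** The limit has as coefficients the eventual values of the coefficients; these
    form a Laurent series because all late terms agree in degrees at most 0. *)
Lemma laurent_field_complete : abs_complete abs.
Proof.
move=> u uc; case/andP: c01 => c0 c1.
have cn (n : int) : 0 < c ^ n by rewrite exprz_gt0.
have /choice[N hN] : forall n : int, exists N : nat, forall i j : nat,
    (N <= i)%N -> (N <= j)%N -> forall m : int, m <= n -> coef (u i) m = coef (u j) m.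
  move=> n; have [N hN] := uc _ (cn n); exists N => i j hi hj m mn.
  by apply/eqP; rewrite -subr_eq0 -laurent_coefB (coef_small_abs (hN i j hi hj)).
pose a (n : int) := coef (u (N n)) n.
have aE n i : (N n <= i)%N -> forall m, m <= n -> coef (u i) m = a m.
  move=> Ni m mn; rewrite /a.
  rewrite (hN n i (maxn i (N m)) Ni) ?leq_max ?Ni //.
  by rewrite (hN m (maxn i (N m)) (N m)) // leq_max leqnn orbT.
have la : laurent a.
  have [m hm] := laurent_coefP (u (N 0)).
  (* In degrees at most 0 the series a agrees with the single term u (N 0). *)
  exists (Num.min m 0) => n; rewrite lt_min => /andP[nm n0].
  by rewrite -(aE 0 (N 0)) ?hm // ltW.
have [x _ xa] : exists2 x, [set: K] x & coef x = a.
  by case: coefP => -[_ _ surj] _ _ _; apply: surj.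
exists x => eps e0.
have [|n hn] := @exists_expr_lt _ c eps _ e0; first by rewrite (ltW c0).
exists (N n) => i Ni; apply: le_lt_trans (hn n (leqnn n)).
apply: (@abs_laurent_le _ n) => m mn.
by rewrite laurent_coefB xa (aE n) // ?subrr // ltW.
Qed.

End LaurentField.

Lemma local_field_complete (R : realType) (K : fieldType) (abs : K -> R) :
  local_field abs -> nonarch_absval abs /\ abs_complete abs.
Proof.
case=> [h|].
  split; last exact: padic_local_field_complete.
  by case: h => [p [c [F [absF [j []]]]]].
move=> [k [c [coef [c01 coefP absP abs_coef]]]]; split=> //.
exact: laurent_field_complete abs_coef.
Qed.

(** * Values of power series with integral coefficients *)

Section SeriesValues.
Variables (R : realType) (K L : fieldType) (iota : {rmorphism K -> L}).
Variables (abs : K -> R) (absL : L -> R).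
Hypotheses (absP : nonarch_absval abs) (absLP : nonarch_absval absL).
Hypothesis absLK : forall x : K, absL (iota x) = abs x.
Variable t : L.
Hypothesis t1 : absL t < 1.

Definition integral_coefs (I : Type) (c : I -> K) : Prop := forall i, abs (c i) <= 1.

Definition series_trunc (c : nat -> K) (N : nat) : {poly L} :=
  \poly_(i < N) iota (c i).

(** An error bound in place of a limit: it determines w, it needs no completeness,
    and its algebraic consequences are finite computations with truncations. *)
Definition series_value (c : nat -> K) (w : L) : Prop :=
  forall N, absL (w - (series_trunc c N).[t]) <= absL t ^+ N.

(** The ultrametric estimate behind all the truncation errors below. *)
Lemma abs_horner_le (p : {poly L}) N : (forall i, absL p`_i <= 1) ->
  (forall i, (i < N)%N -> p`_i = 0) -> absL p.[t] <= absL t ^+ N.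
Proof.
move=> p1 p0; rewrite horner_coef; apply: abs_sum_le => //.
  by rewrite exprn_ge0 // abs_ge0.
move=> i _; have [iN|Ni] := ltnP i N.
  by rewrite p0 // mul0r abs0 // exprn_ge0 // abs_ge0.
rewrite absM // absX // -(subnK Ni) exprD mulrA ler_piMl ?exprn_ge0 ?abs_ge0 //.
by rewrite mulr_ile1 ?exprn_ge0 ?abs_ge0 // exprn_ile1 ?abs_ge0 // ltW.
Qed.

Lemma series_trunc_integral c N i : integral_coefs c -> absL (series_trunc c N)`_i <= 1.
Proof. by move=> c1; rewrite coef_poly; case: ifP => _; rewrite ?absLK ?abs0. Qed.

Lemma series_trunc_le1 c N : integral_coefs c -> absL (series_trunc c N).[t] <= 1.
Proof.
move=> c1; rewrite -(expr0 (absL t)); apply: abs_horner_le => // i.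
exact: series_trunc_integral.
Qed.

Lemma series_trunc_dist c m n : integral_coefs c -> (m <= n)%N ->
  absL ((series_trunc c n).[t] - (series_trunc c m).[t]) <= absL t ^+ m.
Proof.
move=> c1 mn; rewrite -hornerN -hornerD; apply: abs_horner_le => i.
  by rewrite coefB absB_le // series_trunc_integral.
by move=> im; rewrite coefB !coef_poly im (leq_trans im mn) subrr.
Qed.

Lemma series_value_le1 c w : series_value c w -> absL w <= 1.
Proof. by move=> /(_ 0%N); rewrite /series_trunc poly_def big_ord0 horner0 subr0. Qed.

Lemma series_value_cvg c w :
  series_value c w -> abs_cvg absL (fun N => (series_trunc c N).[t]) w.
Proof.
move=> cw eps e0; have [|N hN] := @exists_expr_lt _ (absL t) eps _ e0.
  by rewrite abs_ge0.
by exists N => n /hN; apply: le_lt_trans; rewrite abs_distC.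
Qed.

Lemma series_value_unique c w w' : series_value c w -> series_value c w' -> w = w'.
Proof.
by move=> /series_value_cvg h /series_value_cvg h'; apply: abs_cvg_unique h h'.
Qed.

Lemma series_value_exists (M : set L) c :
  intermediate_field iota M -> complete_in absL M -> M t -> integral_coefs c ->
  exists2 w, M w & series_value c w.
Proof.
move=> MF Mc Mt c1.
have [|eps e0|w Mw cw] := Mc (fun N => (series_trunc c N).[t]).
- move=> N; apply: (adjoin_sub MF Mt); exists (\poly_(i < N) c i).
  congr (_.[t]); apply/polyP => i; rewrite coef_map !coef_poly /=.
  by case: ifP => // _; rewrite rmorph0.
- have [|N hN] := @exists_expr_lt _ (absL t) eps _ e0.
    by rewrite abs_ge0.
  exists N => i j; wlog ij : i j / (i <= j)%N.
    move=> h Ni Nj; have [ij|/ltnW ji] := leqP i j; first exact: h.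
    by rewrite abs_distC //; apply: h.
  move=> Ni _; rewrite abs_distC //; apply: le_lt_trans (hN i Ni).
  exact: series_trunc_dist.
exists w => // N.
apply: (@abs_cvg_le _ _ _ absLP
  (fun n => (series_trunc c (n + N)).[t] - (series_trunc c N).[t])).
  move=> eps /cw[n0 hn]; exists n0 => n n0n.
  by rewrite opprB addrA subrK hn // (leq_trans n0n) // leq_addr.
by move=> n; apply: series_trunc_dist => //; apply: leq_addl.
Qed.

Lemma series_value_poly c (p : {poly L}) : integral_coefs c ->
  (forall i, p`_i = iota (c i)) -> series_value c p.[t].
Proof.
move=> c1 pc N; rewrite -hornerN -hornerD; apply: abs_horner_le => i.
  by rewrite coefB absB_le // ?pc ?absLK // series_trunc_integral.
by move=> iN; rewrite coefB coef_poly iN pc subrr.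
Qed.

Lemma eq_series_value c d w : c =1 d -> series_value c w -> series_value d w.
Proof. by move=> /funext ->. Qed.

Lemma series_valueD c d v w : series_value c v -> series_value d w ->
  series_value (fun i => c i + d i) (v + w).
Proof.
move=> cv dw N; have -> : series_trunc (fun i => c i + d i) N
    = series_trunc c N + series_trunc d N.
  by apply/polyP => i; rewrite coefD !coef_poly; case: ifP; rewrite ?rmorphD ?addr0.
by rewrite hornerD opprD addrACA; apply: absD_le.
Qed.

Definition cauchy_product (c d : nat -> K) (n : nat) : K :=
  \sum_(i < n.+1) c i * d (n - i)%N.

Lemma cauchy_product_integral c d : integral_coefs c -> integral_coefs d ->
  integral_coefs (cauchy_product c d).
Proof.
move=> c1 d1 n; apply: abs_sum_le => // i _.
by rewrite absM // mulr_ile1 // abs_ge0.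
Qed.

(** The product of the truncations and the truncation of the product agree in
    degree less than N. *)
Lemma series_valueM c d v w : integral_coefs c -> integral_coefs d ->
  series_value c v -> series_value d w -> series_value (cauchy_product c d) (v * w).
Proof.
move=> c1 d1 cv dw N.
set C := series_trunc c N; set D := series_trunc d N.
have tN : 0 <= absL t ^+ N by rewrite exprn_ge0 // abs_ge0.
have le1l (x y : L) : absL x <= 1 -> absL y <= absL t ^+ N -> absL (x * y) <= absL t ^+ N.
  by move=> hx hy; rewrite absM //; apply: le_trans hy; rewrite ler_piMl ?abs_ge0.
rewrite (_ : _ - _ = w * (v - C.[t]) + C.[t] * (w - D.[t])
    + (C * D - series_trunc (cauchy_product c d) N).[t]); last first.
  by rewrite hornerD hornerN hornerM; ring.
apply: absD_le => //; first apply: absD_le => //.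
- by apply: le1l; [exact: series_value_le1 dw|exact: cv].
- by apply: le1l; [exact: series_trunc_le1|exact: dw].
apply: abs_horner_le => i.
  rewrite coefB absB_le // ?series_trunc_integral //; last exact: cauchy_product_integral.
  rewrite coefM; apply: abs_sum_le => // j _.
  by rewrite absM // mulr_ile1 ?abs_ge0 // series_trunc_integral.
move=> iN; rewrite coefB coefM coef_poly iN rmorph_sum /=.
apply/eqP; rewrite subr_eq0; apply/eqP/eq_bigr => j _.
rewrite !coef_poly rmorphM /= (leq_trans (ltn_ord j)) //.
by rewrite (leq_ltn_trans (leq_subr j i)).
Qed.

(** Used to lower the order from which a Laurent series is read, and for the leading
    term x of the Böttcher series. *)
Lemma series_value_cons a c w : integral_coefs c -> abs a <= 1 -> series_value c w ->
  series_value (fun n => if n is m.+1 then c m else a) (iota a + t * w).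
Proof.
move=> c1 a1 cw; case=> [|N].
  rewrite /series_trunc poly_def big_ord0 horner0 subr0 expr0; apply: absD_le => //.
    by rewrite absLK.
  rewrite absM // mulr_ile1 ?abs_ge0 //; first exact: ltW.
  exact: series_value_le1 cw.
rewrite horner_poly big_ord_recl /= expr0 mulr1 opprD addrACA subrr add0r.
under eq_bigr do rewrite exprS mulrCA.
rewrite -mulr_sumr -mulrBr absM // exprS ler_wpM2l ?abs_ge0 //.
by have := cw N; rewrite horner_poly.
Qed.

End SeriesValues.

(** * Values of Laurent series *)

Section LaurentAlgebra.
Variable A : fieldType.
Implicit Types (a b c u : int -> A).

Definition supported_from (m : int) a : Prop := forall n : int, n < m -> a n = 0.

Definition coefs_from (m : int) a (k : nat) : A := a (m + k%:Z).

Lemma laurent_mul_support m l a u : supported_from m a -> supported_from l u ->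
  supported_from (m + l) (laurent_mul a u).
Proof.
move=> am ul n nml; apply: fsbig1 => i _.
have [im|mi] := ltP i m; first by rewrite am // mul0r.
by rewrite ul ?mulr0 //; lia.
Qed.

Lemma laurent_mul_coef m l a u (k : nat) : supported_from m a -> supported_from l u ->
  laurent_mul a u (m + l + k%:Z)
    = \sum_(i < k.+1) coefs_from m a i * coefs_from l u (k - i)%N.
Proof.
move=> am ul; rewrite /laurent_mul.
pose h (i : nat) := m + i%:Z.
rewrite -(fsbig_widen (h @` `I_k.+1)) //; last first.
  move=> i [_ hi] /=.
  have [im|mi] := ltP i m; first by rewrite am // mul0r.
  have [ik|ki] := ltP (m + k%:Z) i; first by rewrite ul ?mulr0 //; lia.
  exfalso; apply: hi; exists `|i - m|%N => /=; rewrite /h; lia.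
rewrite fsbig_image; last by move=> i j _ _; rewrite /h; lia.
rewrite -fsbig_ord; apply: eq_bigr => i _; rewrite /h /coefs_from; congr (_ * u _).
by have := ltn_ord i; lia.
Qed.

End LaurentAlgebra.

Section LaurentQuotient.
Variables (R : realType) (K : fieldType) (abs : K -> R) (absP : nonarch_absval abs).
Variables (a u : int -> K) (l s : int).
Hypotheses (la : laurent a) (ul : supported_from l u) (u1 : u l = 1).
Hypothesis ui : integral_coefs abs u.
Hypothesis aui : integral_coefs abs (laurent_mul a u).
Hypothesis aus : supported_from (l + s) (laurent_mul a u).

(** Solving a * u = c for the coefficients of a one after the other is possible
    without division because the leading coefficient of u is 1. *)
Lemma laurent_quotient_rec m (k : nat) : supported_from m a ->
  a (m + k%:Z) = laurent_mul a u (m + l + k%:Z)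
    - \sum_(i < k) coefs_from m a i * coefs_from l u (k - i)%N.
Proof.
move=> am; rewrite (laurent_mul_coef k am ul) big_ord_recr /= subnn.
have -> : coefs_from l u 0 = 1 by rewrite /coefs_from addr0.
by rewrite mulr1 [X in _ = X - _]addrC addrK.
Qed.

Lemma laurent_quotient_integral : integral_coefs abs a.
Proof.
case: la => m am n; have [nm|mn] := ltP n m; first by rewrite am // abs0.
have -> : n = m + `|n - m|%N%:Z by lia.
elim/ltn_ind: `|n - m|%N => k IH; rewrite (laurent_quotient_rec k am).
apply: absB_le => //; apply: abs_sum_le => // i _.
by rewrite absM // mulr_ile1 ?abs_ge0 //; [apply: IH|apply: ui].
Qed.

Lemma laurent_quotient_support : supported_from s a.
Proof.
case: la => m am.
suff as' (k : nat) : m + k%:Z < s -> a (m + k%:Z) = 0.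
  move=> n ns; have [nm|mn] := ltP n m; first by rewrite am.
  have nE : n = m + `|n - m|%N%:Z by lia.
  by rewrite nE as' // -nE.
elim/ltn_ind: k => k IH ks; rewrite (laurent_quotient_rec k am) aus ?sub0r; last by lia.
rewrite big1 ?oppr0 // => i _; have ik := ltn_ord i.
by rewrite /coefs_from IH ?mul0r //; lia.
Qed.

Lemma laurent_quotient_lead : a s = laurent_mul a u (l + s).
Proof.
have := laurent_quotient_rec 0 laurent_quotient_support.
by rewrite big_ord0 !addr0 subr0 (addrC l).
Qed.

End LaurentQuotient.

Section LaurentValues.
Variables (R : realType) (K L : fieldType) (iota : {rmorphism K -> L}).
Variables (abs : K -> R) (absL : L -> R).
Hypotheses (absP : nonarch_absval abs) (absLP : nonarch_absval absL).
Hypothesis absLK : forall x : K, absL (iota x) = abs x.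
Variable t : L.
Hypotheses (t0 : t != 0) (t1 : absL t < 1).

Local Notation series_value := (series_value iota absL t).

(** Evaluation is reduced to power series by factoring out t ^ m, so v itself may
    have any absolute value. *)
Definition laurent_value (m : int) (a : int -> K) (v : L) : Prop :=
  [/\ supported_from m a, integral_coefs abs a &
      series_value (coefs_from m a) (v * t ^ (- m))].

Lemma laurent_value_unique m a v w : laurent_value m a v -> laurent_value m a w -> v = w.
Proof.
move=> [_ _ hv] [_ _ hw]; apply: (mulIf (expfz_neq0 (- m) t0)).
exact: series_value_unique hv hw.
Qed.

Lemma laurent_value_exists (M : set L) m a :
  intermediate_field iota M -> complete_in absL M -> M t ->
  supported_from m a -> integral_coefs abs a -> exists v, laurent_value m a v.
Proof.
move=> MF Mc Mt am a1.
have c1 : integral_coefs abs (coefs_from m a) by move=> k; apply: a1.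
have [w _ aw] := series_value_exists absLP absLK t1 MF Mc Mt c1.
exists (w * t ^ m); split=> //.
by rewrite -mulrA -expfzDr // subrr expr0z mulr1.
Qed.

Lemma laurent_valueM m l a b v w : laurent_value m a v -> laurent_value l b w ->
  laurent_value (m + l) (laurent_mul a b) (v * w).
Proof.
move=> [am a1 av] [bl b1 bw].
have abE : coefs_from (m + l) (laurent_mul a b)
    = cauchy_product (coefs_from m a) (coefs_from l b).
  by apply/funext => k; rewrite /coefs_from laurent_mul_coef.
have abs_ := laurent_mul_support am bl.
split=> //.
  move=> n; have [nml|mln] := ltP n (m + l); first by rewrite abs_ // abs0.
  have -> : n = m + l + `|(n - (m + l))%R|%N%:Z by lia.
  have -> : forall k : nat, laurent_mul a b (m + l + k%:Z)
     = coefs_from (m + l) (laurent_mul a b) k by [].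
  by rewrite abE; apply: cauchy_product_integral => // k; [apply: a1|apply: b1].
rewrite abE opprD expfzDr // mulrACA.
by apply: (series_valueM absP absLP absLK) => // k; [apply: a1|apply: b1].
Qed.

Lemma laurent_value_one : laurent_value 0 (@laurent_one K) 1.
Proof.
split.
- by move=> n n0; rewrite /laurent_one lt_eqF.
- by move=> n; rewrite /laurent_one; case: eqP; rewrite ?abs1 // abs0.
rewrite oppr0 expr0z mulr1 -(hornerC 1 t).
apply: (series_value_poly absLP absLK) => // k.
  by rewrite /coefs_from /laurent_one; case: eqP; rewrite ?abs1 // abs0.
by rewrite coefC /coefs_from /laurent_one add0r; case: k => [|k]; rewrite ?rmorph1 ?rmorph0.
Qed.

Lemma laurent_valueX m a v k : laurent_value m a v ->
  laurent_value (m *+ k) (laurent_exp a k) (v ^+ k).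
Proof.
move=> av; elim: k => [|k IH]; first by rewrite mulr0n expr0; apply: laurent_value_one.
by rewrite mulrS exprS; apply: laurent_valueM.
Qed.

(** The order m is only a lower bound, so values taken with different bounds can be
    compared. *)
Lemma laurent_value_weaken m l a v : l <= m -> laurent_value m a v -> laurent_value l a v.
Proof.
move=> lm; have -> : m = l + `|m - l|%N%:Z by lia.
elim: `|m - l|%N => [|k IH]; first by rewrite addr0.
move=> [am a1 av]; apply: IH; split=> //; first by move=> n nk; apply: am; lia.
have := series_value_cons absLP absLK t1 (a := 0) _ _ av.
rewrite abs0 // rmorph0 add0r => /(_ (fun i => a1 _) ler01).
have -> : t * (v * t ^ (- (l + k.+1%:Z))) = v * t ^ (- (l + k%:Z)).
  by rewrite mulrCA -{1}(expr1z t) -expfzDr //; congr (_ * t ^ _); lia.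
apply: eq_series_value => -[|i]; rewrite /coefs_from; last by congr a; lia.
by rewrite am //; lia.
Qed.

Lemma laurent_valueD m a b v w : laurent_value m a v -> laurent_value m b w ->
  laurent_value m (fun n => a n + b n) (v + w).
Proof.
move=> [am a1 av] [bm b1 bw]; split.
- by move=> n nm; rewrite am // bm // addr0.
- by move=> n; apply: absD_le.
by rewrite mulrDl; apply: (series_valueD absLP).
Qed.

End LaurentValues.

Lemma laurent_of_poly_support (K : fieldType) (f : {poly K}) :
  supported_from (- (size f).-1%:Z) (laurent_of_poly f).
Proof.
move=> n nf; rewrite /laurent_of_poly; case: ifP => // n0.
rewrite nth_default //; move: (size f) nf => s nf; lia.
Qed.

Lemma laurent_of_poly_lead (K : fieldType) (f : {poly K}) : f \is monic ->
  laurent_of_poly f (- (size f).-1%:Z) = 1.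
Proof.
move=> /monicP fm; rewrite /laurent_of_poly.
by rewrite (_ : _ <= 0 = true) ?abszN ?absz_nat -?fm //; lia.
Qed.

Section Values.
Variables (R : realType) (K L : fieldType) (iota : {rmorphism K -> L}).
Variables (abs : K -> R) (absL : L -> R).
Hypotheses (absP : nonarch_absval abs) (absLP : nonarch_absval absL).
Hypothesis absLK : forall x : K, absL (iota x) = abs x.
Variable t : L.
Hypotheses (t0 : t != 0) (t1 : absL t < 1).

Local Notation series_value := (series_value iota absL).
Local Notation laurent_value := (laurent_value iota abs absL t).

(** All terms but the leading one are smaller than it. *)
Lemma laurent_value_lead_abs m a v : laurent_value m a v -> a m = 1 ->
  absL (v * t ^ (- m)) = 1.
Proof.
move=> [_ _ /(_ 1%N)]; rewrite horner_poly big_ord1 expr0 mulr1 expr1.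
rewrite /coefs_from addr0 => /le_lt_trans/(_ t1) h am; rewrite am rmorph1 in h.
have := @absD_dominant _ _ _ absLP 1 (v * t ^ (- m) - 1).
by rewrite abs1 // => /(_ h); rewrite addrC subrK.
Qed.

Lemma laurent_of_poly_integral (f : {poly K}) : f \is a polyOver (integer_ring abs) ->
  integral_coefs abs (laurent_of_poly f).
Proof.
move=> fi n; rewrite /laurent_of_poly; case: ifP => _; last by rewrite abs0.
have [nf|fn] := ltnP `|n|%N (size f); last by rewrite nth_default // abs0.
by move: fi; rewrite qualifE => /allP/(_ _ (mem_nth 0 nf)).
Qed.

Lemma laurent_value_poly (f : {poly K}) : f \is a polyOver (integer_ring abs) ->
  laurent_value (- (size f).-1%:Z) (laurent_of_poly f) (map_poly iota f).[t^-1].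
Proof.
move=> fi; have lfi := laurent_of_poly_integral fi.
split=> //; first exact: laurent_of_poly_support.
set d := (size f).-1.
have -> : (map_poly iota f).[t^-1] * t ^ (- - d%:Z) = (\poly_(k < d.+1) iota f`_(d - k)).[t].
  rewrite opprK -exprnP horner_poly (@horner_coef_wide _ d.+1); last first.
    by rewrite size_map_poly leqSpred.
  rewrite mulr_suml (reindex_inj rev_ord_inj); apply: eq_bigr => i _ /=.
  rewrite subSS coef_map /= -mulrA; congr (_ * _).
  have id : (i <= d)%N by rewrite -ltnS.
  by rewrite exprVn -[X in _ * t ^+ X](subnK id) exprD mulKf // expf_neq0.
apply: (series_value_poly absLP absLK t1) => [k|k]; first exact: lfi.
rewrite coef_poly /coefs_from /laurent_of_poly ltnS.
case: (leqP k d) => kd.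
  rewrite (_ : _ <= 0 = true); last by lia.
  by congr (iota f`_ _); lia.
case: ifP => h; last by rewrite rmorph0.
by lia.
Qed.

Lemma laurent_value_boettcher b g : integral_coefs abs b -> series_value t b g ->
  laurent_value (-1) (boettcher_series b) (t^-1 + g).
Proof.
move=> bi bg; split.
- by case=> [k|[|k]] h //; lia.
- by case=> [k|[|k]]; rewrite ?bi //= ?abs1 // abs0.
have -> : (t^-1 + g) * t ^ (- -1) = iota 1 + t * g.
  by rewrite opprK expr1z mulrDl mulVf // rmorph1 (mulrC t).
have a1 : abs 1 <= 1 by rewrite abs1.
apply: eq_series_value (series_value_cons absLP absLK t1 bi a1 bg).
case=> [|k]; rewrite /coefs_from; first by rewrite addr0.
by have -> : -1 + k.+1%:Z = k%:Z by lia.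
Qed.

(** Up to an error of size |t| ^ N only the terms k < N of the substitution
    matter, since Psi vanishes to positive order; for them the sums over k and over
    the degree are both finite and can be exchanged. *)
Lemma laurent_value_comp b Psi m psi h : 0 < m -> absL psi <= absL t ->
  integral_coefs abs b -> laurent_value m Psi psi -> series_value psi b h ->
  laurent_value 0 (fun n => \sum_(k \in [set: nat]) b k * laurent_exp Psi k n) h.
Proof.
move=> m0 psit bi Psiv bh; set G := fun n => _.
have Pv k : laurent_value (m *+ k) (laurent_exp Psi k) (psi ^+ k).
  exact: laurent_valueX.
have P0 k (n : int) : n < k%:Z -> laurent_exp Psi k n = 0.
  move=> nk; have [h1 _ _] := Pv k; apply: h1; apply: lt_le_trans nk _.
  by rewrite -mulr_natr natz; nia.
have Pw k : laurent_value 0 (laurent_exp Psi k) (psi ^+ k).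
  by apply: laurent_value_weaken (Pv k) => //; rewrite mulrn_wge0 // ltW.
have GE (N : nat) (n : int) : n < N%:Z -> G n = \sum_(k < N) b k * laurent_exp Psi k n.
  move=> nN; rewrite (fsbig_ord _ _ (fun k => b k * laurent_exp Psi k n)) /G.
  apply/esym/fsbig_widen => // k [_ /= kN].
  by rewrite P0 ?mulr0 //; lia.
have Pi k : integral_coefs abs (laurent_exp Psi k) by have [] := Pw k.
split.
- by move=> n n0; rewrite (GE 0%N) // big_ord0.
- move=> n; rewrite (GE `|n|.+1) ?abs_sum_le // => [k _|]; last by lia.
  by rewrite absM // mulr_ile1 ?abs_ge0 //; apply: Pi.
move=> N; rewrite oppr0 expr0z mulr1.
(* The truncated value of the k-th power of Psi. *)
pose S k := (series_trunc iota (coefs_from 0 (laurent_exp Psi k)) N).[t].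
have -> : (series_trunc iota (coefs_from 0 G) N).[t] = \sum_(k < N) iota (b k) * S k.
  rewrite horner_poly.
  under [RHS]eq_bigr do rewrite /S horner_poly mulr_sumr.
  rewrite exchange_big; apply: eq_bigr => n _ /=.
  rewrite /coefs_from (GE N) ?add0r; last by have := ltn_ord n; lia.
  by rewrite rmorph_sum mulr_suml; apply: eq_bigr => k _; rewrite rmorphM mulrA.
have tN : 0 <= absL t ^+ N by rewrite exprn_ge0 // abs_ge0.
apply: (@abs_dist_le _ _ _ absLP _ (series_trunc iota b N).[psi]) => //.
  by apply: le_trans (bh N) _; rewrite lerXn2r ?nnegrE ?abs_ge0.
rewrite horner_poly -sumrB; apply: abs_sum_le => // k _.
rewrite -mulrBr absM // absLK; have [_ _ /(_ N)] := Pw k.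
rewrite oppr0 expr0z mulr1; apply: le_trans.
by rewrite ler_piMl ?abs_ge0.
Qed.

End Values.

(** * The functional equation *)

Section FunctionalEquation.
Variables (R : realType) (K L : fieldType) (iota : {rmorphism K -> L}).
Variables (abs : K -> R) (absL : L -> R).
Hypotheses (absP : nonarch_absval abs) (absLP : nonarch_absval absL).
Hypothesis absLK : forall x : K, absL (iota x) = abs x.

(** The leading term dominates where |z| > 1. *)
Lemma abs_horner_monic (f : {poly K}) z : f \is a polyOver (integer_ring abs) ->
  f \is monic -> 1 < absL z -> absL (map_poly iota f).[z] = absL z ^+ (size f).-1.
Proof.
move=> fi fm z1; have z0 : z != 0.
  by apply: contraTneq z1 => ->; rewrite abs0 // ltr10.
have V0 : z^-1 != 0 by rewrite invr_eq0.
have V1 : absL z^-1 < 1 by rewrite absV // invf_lt1 // (lt_trans _ z1).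
have := laurent_value_lead_abs absLP V1
  (laurent_value_poly absP absLP absLK V0 V1 fi) (laurent_of_poly_lead fm).
rewrite invrK opprK -exprnP absM // absX // absV // exprVn => h.
have zd : absL z ^+ (size f).-1 != 0 by rewrite expf_neq0 // gt_eqF // (lt_trans _ z1).
by apply: (mulIf (invr_neq0 zd)); rewrite h divff.
Qed.

Lemma horner_monic_neq0 (f : {poly K}) z : f \is a polyOver (integer_ring abs) ->
  f \is monic -> 1 < absL z -> (map_poly iota f).[z] != 0.
Proof.
move=> fi fm z1; apply: contraTneq (z1) => h0.
have := abs_horner_monic fi fm z1; rewrite h0 abs0 // => /esym/eqP.
by rewrite expf_eq0 => /andP[_ /eqP ->]; rewrite ltr10.
Qed.

Variables (f1 f2 : {poly K}) (e : nat) (b : nat -> K).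
Hypotheses (f1i : f1 \is a polyOver (integer_ring abs)) (f1m : f1 \is monic).
Hypotheses (f2i : f2 \is a polyOver (integer_ring abs)) (f2m : f2 \is monic).
Hypotheses (e0 : (0 < e)%N) (hdeg : (size f1).-1 = ((size f2).-1 + e)%N).
Hypothesis bP : is_boettcher abs f1 f2 e b.

(** Both sides of the identity b o phi = b ^ e of formal series are evaluated at
    t = 1 / z. The subfield M supplies the values of Phi and Psi, which are then
    identified as v = f1(z) / f2(z) and 1 / v by uniqueness of values. *)
Lemma boettcher_functional_equation (M : set L) z v g h :
  intermediate_field iota M -> complete_in absL M -> M z -> 1 < absL z ->
  v * (map_poly iota f2).[z] = (map_poly iota f1).[z] ->
  series_value iota absL z^-1 b g -> series_value iota absL v^-1 b h ->
  v + h = (z + g) ^+ e.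
Proof.
move=> MF Mc Mz z1 vE bg bh.
have z0 : z != 0 by apply: contraTneq z1 => ->; rewrite abs0 // ltr10.
set t := z^-1; have t0 : t != 0 by rewrite invr_eq0.
have t1 : absL t < 1 by rewrite absV // invf_lt1 // (lt_trans _ z1).
have Mt : M t by case: MF => _ _ _; apply.
case: bP => bi [Phi [Psi [[lPhi lPsi] PhiE PsiE compE]]].
have f2z0 := horner_monic_neq0 f2i f2m z1.
have f1v := laurent_value_poly absP absLP absLK t0 t1 f1i.
have f2v := laurent_value_poly absP absLP absLK t0 t1 f2i.
rewrite invrK -/t in f1v f2v.
have [f1s f1int _] := f1v; have [f2s f2int _] := f2v.
have f2l := laurent_of_poly_lead f2m.
have dE : - (size f2).-1%:Z + - e%:Z = - (size f1).-1%:Z by rewrite hdeg; lia.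
have PhiI : integral_coefs abs Phi.
  by apply: (laurent_quotient_integral absP lPhi f2s) => //; rewrite PhiE.
have PhiS : supported_from (- e%:Z) Phi.
  by apply: (laurent_quotient_support lPhi f2s) => //; rewrite PhiE dE.
have PhiL : Phi (- e%:Z) = 1.
  rewrite (laurent_quotient_lead lPhi f2s) ?PhiE ?dE //.
  exact: laurent_of_poly_lead.
have [v' Phiv] := laurent_value_exists absLP absLK t0 t1 MF Mc Mt PhiS PhiI.
have Ev : v' = v.
  apply: (mulIf f2z0); rewrite vE.
  have := laurent_valueM absP absLP absLK t0 t1 Phiv f2v.
  by rewrite PhiE addrC dE => hv; apply: laurent_value_unique hv f1v.
rewrite {v'}Ev in Phiv.
have onev := laurent_value_one absP absLP absLK t1.
have [ones onei _] := onev.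
have PsiI : integral_coefs abs Psi.
  by apply: (laurent_quotient_integral absP lPsi PhiS) => //; rewrite PsiE.
have PsiS : supported_from e%:Z Psi.
  by apply: (laurent_quotient_support lPsi PhiS) => //; rewrite PsiE addNr.
have [psi Psiv] := laurent_value_exists absLP absLK t0 t1 MF Mc Mt PsiS PsiI.
have psiv1 : psi * v = 1.
  have := laurent_valueM absP absLP absLK t0 t1 Psiv Phiv.
  by rewrite PsiE subrr => hv; apply: laurent_value_unique hv onev.
have v0 : v != 0 by apply: contra_eq_neq psiv1 => ->; rewrite mulr0 eq_sym oner_eq0.
have Epsi : psi = v^-1 by rewrite -[psi](mulfK v0) psiv1 mul1r.
have absv : absL v = absL z ^+ e.
  have := laurent_value_lead_abs absLP t1 Phiv PhiL.
  rewrite opprK -exprnP absM // absX // absV // exprVn => hv.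
  have zd : absL z ^+ e != 0 by rewrite expf_neq0 // gt_eqF // (lt_trans _ z1).
  by apply: (mulIf (invr_neq0 zd)); rewrite hv divff.
have psit : absL psi <= absL t.
  rewrite Epsi !absV // absv lef_pV2 ?posrE ?exprn_gt0 ?(lt_trans _ z1) //.
  by rewrite -(prednK e0) exprS ler_peMr ?abs_ge0 // exprn_ege1 // ltW.
rewrite -Epsi in bh.
have Gv := laurent_value_comp absP absLP absLK t0 t1 (m := e%:Z) _ psit bi Psiv bh.
have le0 : - e%:Z <= 0 by lia.
have Gve := laurent_value_weaken absP absLP absLK t0 t1 le0 (Gv e0).
have cv := laurent_valueD absP absLP Phiv Gve.
have bv := laurent_valueX absP absLP absLK t0 t1 e
  (laurent_value_boettcher absP absLP absLK t0 t1 bi bg).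
rewrite invrK mulNrn natz -compE in bv.
exact: laurent_value_unique cv bv.
Qed.

End FunctionalEquation.

(** * The map defined by the Böttcher coordinate *)

Section BoettcherEvaluation.
Variables (R : realType) (K F : fieldType) (j : {rmorphism K -> F}).
Variables (abs : K -> R) (absF : F -> R).
Hypotheses (absP : nonarch_absval abs) (absFP : nonarch_absval absF).
Hypothesis absFK : forall x : K, absF (j x) = abs x.

Lemma abs_inv_lt1 z : 1 < absF z -> absF z^-1 < 1.
Proof. by move=> z1; rewrite absV // invf_lt1 // (lt_trans _ z1). Qed.

Lemma abs_gt1_neq0 z : 1 < absF z -> z != 0.
Proof. by apply: contraTneq => ->; rewrite abs0 // ltr10. Qed.

(** Connects the limit in the definition of the evaluation with the error bounds
    of series_value. *)
Lemma boettcher_eval_series b z g : 1 < absF z ->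
  series_value j absF z^-1 b g -> boettcher_eval absF j b z = z + g.
Proof.
move=> z1 bg; apply: xget_unique => [/= eps e0|y /= hy].
  have [N hN] := series_value_cvg absFP (abs_inv_lt1 z1) bg e0; exists N => n /hN.
  rewrite horner_poly big_mkord opprD addrACA subrr add0r.
  by under [X in _ -> absF (X - _) < _]eq_bigr do rewrite -exprVn.
apply: (abs_cvg_unique absFP hy) => eps e0.
have [N hN] := series_value_cvg absFP (abs_inv_lt1 z1) bg e0; exists N => n /hN.
rewrite horner_poly big_mkord opprD addrACA subrr add0r.
by under [X in _ -> absF (X - _) < _]eq_bigr do rewrite -exprVn.
Qed.

Lemma abs_horner_lipschitz (p : {poly F}) x y : (forall i, absF p`_i <= 1) ->
  absF x <= 1 -> absF y <= 1 -> absF (p.[x] - p.[y]) <= absF (x - y).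
Proof.
move=> p1 x1 y1; rewrite !horner_coef -sumrB; apply: abs_sum_le => //.
  exact: abs_ge0.
move=> i _; rewrite -mulrBr subrXX mulrCA absM // ler_piMr ?abs_ge0 //.
rewrite absM // mulr_ile1 ?abs_ge0 //; apply: abs_sum_le => // k _.
by rewrite absM // !(absX absFP) mulr_ile1 ?exprn_ge0 ?abs_ge0 // exprn_ile1 ?abs_ge0.
Qed.

(** A power series with integral coefficients does not increase distances in the
    open unit disc. *)
Lemma series_value_lipschitz c x y v w : integral_coefs abs c ->
  absF x < 1 -> absF y < 1 -> series_value j absF x c v -> series_value j absF y c w ->
  absF (v - w) <= absF (x - y).
Proof.
move=> c1 x1 y1 cv cw; apply: (@abs_cvg_le _ _ _ absFP
    (fun N => (series_trunc j c N).[x] - (series_trunc j c N).[y])) => [eps e0|N].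
  have [N hN] := series_value_cvg absFP x1 cv e0.
  have [N' hN'] := series_value_cvg absFP y1 cw e0.
  exists (maxn N N') => n; rewrite geq_max => /andP[/hN h /hN' h'].
  rewrite (_ : _ - _ = ((series_trunc j c n).[x] - v) - ((series_trunc j c n).[y] - w)).
    by apply: absD_lt; rewrite ?absN.
  by ring.
by apply: abs_horner_lipschitz; rewrite ?ltW // => i; apply: (series_trunc_integral absFP absFK).
Qed.

End BoettcherEvaluation.

Lemma series_value_map (R : realType) (K F L : fieldType) (j : {rmorphism K -> F})
    (i : {rmorphism K -> L}) (s : {rmorphism F -> L}) (absF : F -> R) (absL : L -> R)
    (t : F) (c : nat -> K) (w : F) :
  (forall x, s (j x) = i x) -> (forall y, absL (s y) = absF y) ->
  series_value j absF t c w -> series_value i absL (s t) c (s w).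
Proof.
move=> sj sabs cw N; rewrite sabs.
have -> : series_trunc i c N = map_poly s (series_trunc j c N).
  apply/polyP => k; rewrite coef_map !coef_poly /=.
  by case: ifP => _; rewrite ?sj ?rmorph0.
by rewrite horner_map -rmorphB sabs.
Qed.

Lemma abs_cauchy_geometric (R : realType) (F : fieldType) (abs : F -> R) (u : nat -> F) r :
  nonarch_absval abs -> 0 <= r < 1 -> (forall n, abs (u n.+1 - u n) <= r ^+ n) ->
  abs_cauchy abs u.
Proof.
move=> absP r01 ur eps e0; have [N hN] := exists_expr_lt r01 e0.
case/andP: r01 => r0 r1.
have hu m n : (n <= m)%N -> abs (u m - u n) <= r ^+ n.
  move=> /subnK <-; elim: (m - n)%N => [|k IH].
    by rewrite add0n subrr abs0 // exprn_ge0.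
  rewrite addSn; apply: (abs_dist_le absP _ IH); apply: le_trans (ur _) _.
  by rewrite exprD ler_piMl ?exprn_ge0 // exprn_ile1 // ltW.
exists N => m n hm hn; have [nm|/ltnW mn] := leqP n m.
  by apply: le_lt_trans (hu _ _ nm) (hN _ hn).
by rewrite abs_distC //; apply: le_lt_trans (hu _ _ mn) (hN _ hm).
Qed.

Section BoettcherMap.
Variables (R : realType) (K L : fieldType) (iota : {rmorphism K -> L}).
Variables (abs : K -> R) (absL : L -> R).
Hypotheses (absP : nonarch_absval abs) (absLP : nonarch_absval absL).
Hypothesis absLK : forall x : K, absL (iota x) = abs x.
Hypothesis Kcomplete : abs_complete abs.
Hypothesis algebraicL : forall x : L,
  exists2 q : {poly K}, q != 0 & root (map_poly iota q) x.
Variable b : nat -> K.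
Hypothesis b1 : integral_coefs abs b.

Local Notation bL := (boettcher_eval absL iota b).

Lemma boettcher_tail z : 1 < absL z ->
  adjoin iota z (bL z - z) /\ series_value iota absL z^-1 b (bL z - z).
Proof.
move=> z1; have zF := adjoin_field algebraicL z.
have zc : complete_in absL (adjoin iota z).
  exact: (adjoin_complete absP Kcomplete algebraicL).
have zV : adjoin iota z z^-1 by case: zF => _ _ _; apply; apply: adjoin_id.
have [g zg bg] := series_value_exists absLP absLK (abs_inv_lt1 absLP z1) zF zc zV b1.
by rewrite (boettcher_eval_series absLP z1 bg) addrC addKr.
Qed.

Lemma boettcher_tail_le1 z : 1 < absL z -> absL (bL z - z) <= 1.
Proof. by move=> /boettcher_tail[_]; apply: series_value_le1. Qed.

Lemma boettcher_adjoin z : 1 < absL z -> adjoin iota z (bL z).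
Proof.
move=> /boettcher_tail[zg _]; rewrite -(subrK z (bL z)) -[X in _ + X]opprK.
apply: adjoinB => //; rewrite -[- z]sub0r; apply: adjoinB (adjoin_id _ _).
by rewrite -(rmorph0 iota); apply: adjoinC.
Qed.

Lemma boettcher_abs z : 1 < absL z -> absL (bL z) = absL z.
Proof.
move=> z1; rewrite -(subrK z (bL z)) addrC absD_dominant //.
by apply: le_lt_trans (z1); apply: boettcher_tail_le1.
Qed.

(** The tail is a series in 1 / z, and |1/z - 1/w| = |z - w| / (|z| |w|). *)
Lemma boettcher_tail_contraction z w : 1 < absL z -> 1 < absL w ->
  absL ((bL z - z) - (bL w - w)) <= (absL z)^-1 * absL (z - w).
Proof.
move=> z1 w1; have [_ hz] := boettcher_tail z1; have [_ hw] := boettcher_tail w1.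
have zV := abs_inv_lt1 absLP z1; have wV := abs_inv_lt1 absLP w1.
apply: le_trans (series_value_lipschitz absLP absLK b1 zV wV hz hw) _.
have [z0 w0] := (abs_gt1_neq0 absLP z1, abs_gt1_neq0 absLP w1).
have -> : z^-1 - w^-1 = z^-1 * (w^-1 * (w - z)) by field; rewrite z0 w0.
rewrite absM // absV // ler_wpM2l ?invr_ge0 ?abs_ge0 //.
by rewrite absM // (abs_distC absLP z) ler_piMl ?abs_ge0 // ltW.
Qed.

Lemma boettcher_isometry z w : 1 < absL z -> 1 < absL w ->
  absL (bL z - bL w) = absL (z - w).
Proof.
move=> z1 w1; have [->|zw] := eqVneq z w; first by rewrite !subrr.
(* The difference of the tails is strictly smaller than z - w. *)
have -> : bL z - bL w = (z - w) + ((bL z - z) - (bL w - w)) by ring.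
apply: absD_dominant => //.
apply: le_lt_trans (boettcher_tail_contraction z1 w1) _.
by rewrite gtr_pMl ?abs_gt0 ?subr_eq0 // invf_lt1 // (lt_trans _ z1).
Qed.

Lemma boettcher_inj z w : 1 < absL z -> 1 < absL w -> bL z = bL w -> z = w.
Proof.
move=> z1 w1 zw; apply/eqP; rewrite -subr_eq0; apply/eqP/(abs_eq0 absLP).
by rewrite -boettcher_isometry // zw subrr abs0.
Qed.

(** The equation b(z) = w says that z is a fixed point of z |-> w - (b(z) - z), a
    contraction of the sphere |z| = |w| that preserves K(w). *)
Lemma boettcher_surj w : 1 < absL w ->
  exists z, [/\ 1 < absL z, bL z = w & adjoin iota w z].
Proof.
move=> w1; have wF := adjoin_field algebraicL w.
have wc : complete_in absL (adjoin iota w).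
  exact: (adjoin_complete absP Kcomplete algebraicL).
pose u n := iter n (fun z => w - (bL z - z)) w.
have uS n : u n.+1 = w - (bL (u n) - u n) by [].
have uabs n : absL (u n) = absL w.
  elim: n => //= n IH; apply: absD_dominant => //; rewrite absN //.
  by apply: le_lt_trans (w1); apply: boettcher_tail_le1; rewrite IH.
have u1 n : 1 < absL (u n) by rewrite uabs.
have uw n : adjoin iota w (u n).
  elim: n => [|n IH]; first exact: adjoin_id.
  by apply: adjoinB; [exact: adjoin_id|apply: adjoin_trans IH _; apply: (boettcher_tail _).1].
have w0 : 0 < absL w by apply: lt_trans (w1).
have r01 : 0 <= (absL w)^-1 < 1 by rewrite invr_ge0 ltW //= invf_lt1.
have uC : abs_cauchy absL u.
  apply: abs_cauchy_geometric r01 _ => // n; elim: n => [|n IH].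
    by rewrite /= addrAC subrr add0r absN // boettcher_tail_le1.
  have -> : u n.+2 - u n.+1 = (bL (u n) - u n) - (bL (u n.+1) - u n.+1).
    by rewrite [u n.+2]uS [X in _ - X = _]uS; ring.
  apply: le_trans (boettcher_tail_contraction _ _) _ => //.
  by rewrite uabs (abs_distC absLP) exprS ler_wpM2l // ltW // invr_gt0.
have [z wz uz] := wc u uw uC.
have zabs : absL z = absL w.
  have [N /(_ N (leqnn N)) hN] := uz _ w0.
  rewrite -(subrK (u N) z) addrC absD_dominant //.
  by rewrite uabs abs_distC.
have z1 : 1 < absL z by rewrite zabs.
exists z; split=> //; apply/eqP; rewrite -subr_eq0; apply/eqP/(abs_eq0 absLP)/eqP.
rewrite eq_le abs_ge0 // andbT leNgt; apply/negP => h.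
have [N hN] := uz _ h; have := hN N.+1 (leqnSn N); have := hN N (leqnn N).
move=> h1 h2; have : absL (bL z - w) < absL (bL z - w).
  rewrite {1}(_ : bL z - w = (z - u N.+1) + ((bL z - z) - (bL (u N) - u N))).
    apply: absD_lt => //; first by rewrite abs_distC.
    apply: le_lt_trans (boettcher_tail_contraction z1 (u1 N)) _.
    rewrite abs_distC //; apply: le_lt_trans h1.
    by rewrite ler_piMl ?abs_ge0 // zabs; case/andP: r01 => _ /ltW.
  by rewrite uS; ring.
by rewrite ltxx.
Qed.

(** Composing the absolute value with s gives another extension of the one of K. *)
Lemma galois_absE s y : galois_aut iota s -> absL (s y) = absL y.
Proof.
move=> [_ sK]; apply: (absval_extension_unique absP Kcomplete algebraicL
    (abs1 := absL \o s)) => //; last by move=> x /=; rewrite sK.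
split=> /=.
- by move=> x; apply: abs_ge0.
- by move=> x; rewrite (abs_eq0 absLP); split=> [/eqP|->]; rewrite ?rmorph0 // fmorph_eq0 => /eqP.
- by move=> x x'; rewrite rmorphM absM.
- by move=> x x'; rewrite rmorphD; case: absLP.
Qed.

Lemma boettcher_galois s z : galois_aut iota s -> 1 < absL z -> bL (s z) = s (bL z).
Proof.
move=> sG z1; have sz1 : 1 < absL (s z) by rewrite galois_absE.
have [_ hz] := boettcher_tail z1.
have := series_value_map (s := s) sG.2 (fun y => galois_absE y sG) hz.
rewrite fmorphV => /(boettcher_eval_series absLP sz1) ->.
by rewrite -rmorphD addrC subrK.
Qed.

Lemma boettcher_base gamma : 1 < abs gamma ->
  bL (iota gamma) = iota (boettcher_eval abs idfun b gamma).
Proof.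
move=> g1; have ig1 : 1 < absL (iota gamma) by rewrite absLK.
have KF : intermediate_field (idfun : {rmorphism K -> K}) [set: K] by [].
have Kc : complete_in abs [set: K].
  by move=> u _ /Kcomplete[l ul]; exists l.
have [g _ bg] := series_value_exists (iota := idfun) absP (fun=> erefl) (abs_inv_lt1 absP g1)
  KF Kc (I : [set: K] gamma^-1) b1.
rewrite (boettcher_eval_series absP g1 bg) rmorphD.
have := series_value_map (j := idfun) (i := iota) (s := iota) (fun=> erefl) absLK bg.
by rewrite fmorphV => /(boettcher_eval_series absLP ig1).
Qed.

End BoettcherMap.

(** * Trees given by levels and a parent map *)

Section LevelledTree.
Variables (W : eqType) (level : W -> nat) (V : set W) (adj : W -> W -> Prop).
Variables (parent : W -> W) (r : W).

Definition child (v w : W) : Prop := level w = (level v).+1 /\ parent w = v.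

Hypotheses (Vr : V r) (level_root : level r = 0%N).
Hypothesis root_unique : forall v, V v -> level v = 0%N -> v = r.
Hypothesis parentP : forall v, V v -> (0 < level v)%N ->
  V (parent v) /\ child (parent v) v.
Hypothesis adjP : forall v w, V v -> V w -> adj v w <-> child v w \/ child w v.

Let edge x y := `[< V y /\ adj x y >].

Lemma edgeP x y : V x -> edge x y -> V y /\ (child x y \/ child y x).
Proof. by move=> Vx /asboolP[Vy /(adjP Vx Vy)]. Qed.

Lemma child_edge x y : V x -> V y -> child x y -> edge x y /\ edge y x.
Proof. by move=> Vx Vy xy; split; apply/asboolP; split=> //; apply/adjP; auto. Qed.

Lemma path_last_vertex u p : V u -> path edge u p -> V (last u p).
Proof. by elim: p u => //= x p IH u Vu /andP[/(edgeP Vu)[Vx _]]; apply: IH. Qed.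

(** A simple path that has gone from a vertex to a child can never go up again,
    because going up would mean returning through the parent it came from. *)
Lemma simple_path_down u x p : V u -> V x -> child u x ->
  path edge x p -> uniq (u :: x :: p) -> (level u < level (last x p))%N.
Proof.
elim: p u x => [|y p IH] u x Vu Vx [lx px]; first by rewrite /= lx.
rewrite [path _ _ _]/= => /andP[/(edgeP Vx)[Vy [xy|[_ yx]]] yp].
  move=> /= /andP[_ xyp]; apply: ltn_trans (IH x y Vx Vy xy yp xyp).
  by rewrite lx.
by rewrite /= -yx px !inE eqxx !orbT.
Qed.

(** The same for the reversed path: a simple path that ends by going up has gone up
    all along. *)
Lemma simple_path_up u v p : V u -> child v (last u p) ->
  path edge u (rcons p v) -> uniq (u :: rcons p v) -> (level v < level u)%N.
Proof.
elim/last_ind: p v => [|p y IH] v Vu; first by move=> [-> _].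
rewrite last_rcons rcons_path last_rcons => -[ly py] /andP[yp _] U.
have Uy : uniq (u :: rcons p y).
  by move: U; rewrite -rcons_cons rcons_uniq => /andP[].
have Vz : V (last u p).
  by move: yp; rewrite rcons_path => /andP[pp _]; apply: path_last_vertex pp.
have : edge (last u p) y by move: yp; rewrite rcons_path => /andP[].
move=> /(edgeP Vz)[Vy [[_ zy]|yz]]; last first.
  by apply: ltn_trans (IH y Vu yz yp Uy); rewrite ly.
move: U; rewrite -rcons_cons rcons_uniq -py zy => /andP[/negP[]].
by rewrite -rcons_cons mem_rcons inE mem_last orbT.
Qed.

Lemma simple_loop (u : W) p : uniq (u :: p) -> last u p = u -> p = [::].
Proof.
by case: p => // x p /= /andP[up _] px; rewrite -px mem_last in up.
Qed.

(** At the end point of higher level a simple path has no choice: its step there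
    must go to (or come from) the parent. Removing that step from both paths
    lowers the sum of the levels. *)
Lemma simple_path_unique u v p q : V u -> V v ->
  path edge u p -> last u p = v -> uniq (u :: p) ->
  path edge u q -> last u q = v -> uniq (u :: q) -> p = q.
Proof.
move: {2}(level u + level v)%N (leqnn (level u + level v)) => n.
elim: n u v p q => [|n IH] u v p q hn Vu Vv pp pv pU qq qv qU.
  have uv : u = v.
    move: hn; rewrite leqn0 addn_eq0 => /andP[/eqP hu /eqP hv].
    by rewrite (root_unique Vu hu) (root_unique Vv hv).
  by rewrite -uv in pv qv; rewrite (simple_loop pU pv) (simple_loop qU qv).
have [uv|uv] := eqVneq u v.
  by rewrite -uv in pv qv; rewrite (simple_loop pU pv) (simple_loop qU qv).
have [uv_lt|vu_le] := ltnP (level u) (level v).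
  have last_step s : path edge u s -> last u s = v -> uniq (u :: s) ->
      exists s', [/\ s = rcons s' v, path edge u s', last u s' = parent v,
        level v = (level (last u s')).+1 & uniq (u :: s')].
    case/lastP: s => [|s x]; first by move=> _ /= h; rewrite h eqxx in uv.
    rewrite last_rcons => sp xv sU; rewrite {}xv in sp sU *; exists s.
    have [ss se] : path edge u s /\ edge (last u s) v.
      by move: sp; rewrite rcons_path => /andP[].
    have sU' : uniq (u :: s) by move: sU; rewrite -rcons_cons rcons_uniq => /andP[].
    have [_ [[h1 h2]|h]] := edgeP (path_last_vertex Vu ss) se; first by split.
    by have := simple_path_up Vu h sp sU; rewrite ltnNge ltnW.
  have [p' [-> pp' pl lp pU']] := last_step p pp pv pU.
  have [q' [-> qq' ql lq qU']] := last_step q qq qv qU.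
  congr rcons; apply: (IH u (parent v)) => //.
    by rewrite -pl -ltnS -addnS -lp.
  by rewrite -pl; apply: path_last_vertex.
have first_step s : path edge u s -> last u s = v -> uniq (u :: s) ->
    exists s', [/\ s = parent u :: s', path edge (parent u) s', last (parent u) s' = v,
      level u = (level (parent u)).+1 /\ V (parent u) & uniq (parent u :: s')].
  case: s => [|x s]; first by move=> _ /= h; rewrite h eqxx in uv.
  move=> /= /andP[ux sp] sv sU; have [Vx [h|[h1 h2]]] := edgeP Vu ux.
    by have := simple_path_down Vu Vx h sp sU; rewrite sv ltnNge vu_le.
  by rewrite -h2 in sp sv h1 sU Vx *; exists s; split=> //; case/andP: sU.
have [p' [-> pp' pv' [lu Vpu] pU']] := first_step p pp pv pU.
have [q' [-> qq' qv' _ qU']] := first_step q qq qv qU.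
by congr cons; apply: (IH (parent u) v) => //; rewrite -ltnS -addSn -lu.
Qed.

Lemma path_to_root v : V v ->
  (exists2 p, path edge v p & last v p = r) /\ (exists2 p, path edge r p & last r p = v).
Proof.
move: {2}(level v) (erefl (level v)) => n; elim: n v => [|n IH] v lv Vv.
  by rewrite (root_unique Vv lv); split; exists [::].
have [|Vp vp] := parentP Vv; first by rewrite lv.
have [|[p pp pr] [q qq qv]] := IH (parent v) _ Vp.
  by apply/eqP; rewrite -eqSS -vp.1 lv.
have [e1 e2] := child_edge Vp Vv vp.
split; first by exists (parent v :: p) => //=; rewrite e2.
by exists (rcons q v); rewrite ?last_rcons // rcons_path qq qv.
Qed.

Lemma levelled_is_tree : is_tree V adj.
Proof.
split; first by exists r.
move=> u v Vu Vv; have [[p pp pr] _] := path_to_root Vu.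
have [_ [q qq qv]] := path_to_root Vv.
have pq : path edge u (p ++ q) by rewrite cat_path pp pr.
have lv : last u (p ++ q) = v by rewrite last_cat pr.
case/shortenP: pq lv => s sp sU _ sv.
exists s; split; first by split.
by move=> s' [sp' sv' sU']; apply: (simple_path_unique Vu Vv).
Qed.

End LevelledTree.

(** * Values of rational functions *)

(** The representative chosen for a fraction is unknown; it is only determined up
    to this cross product. *)
Lemma repr_frac (A : idomainType) (f1 f2 : A) : f2 != 0 ->
  let x := FracField.tofrac f1 / FracField.tofrac f2 in
  \n_(repr x) * f2 = f1 * \d_(repr x).
Proof.
move=> f20 x.
have xE : x = \pi_({fraction A})%qT (Ratio f1 f2).
  rewrite /x; unlock FracField.tofrac.
  rewrite -[X in _ * X]FracField.pi_inv -[LHS]FracField.pi_mul; congr (\pi)%qT.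
  rewrite /FracField.mulf /FracField.invf !numden_Ratio ?oner_neq0 //.
  by rewrite mulr1 mul1r.
have := FracField.equivf_l (Ratio f1 f2); rewrite -xE !numden_Ratio // => ->.
by rewrite mulrC.
Qed.

Section RationalFunctionMap.
Variables (K L : fieldType) (iota : {rmorphism K -> L}).

(** Dividing the chosen representative by its gcd gives coprime n', d' with
    n' * f2 = f1 * d'; hence f1 and f2 are the multiples of n' and d' by one
    polynomial, which does not vanish at z. *)
Lemma ratfun_mapE (f1 f2 : {poly K}) (z : L) : (map_poly iota f2).[z] != 0 ->
  ratfun_map iota (FracField.tofrac f1 / FracField.tofrac f2) (Some z)
    = Some ((map_poly iota f1).[z] / (map_poly iota f2).[z]).
Proof.
move=> f2z; have f20 : f2 != 0 by apply: contraNneq f2z => ->; rewrite rmorph0 horner0.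
have := repr_frac f1 f20; rewrite /ratfun_map.
move: (repr _) => x /=; set n := \n_x; set d := \d_x => E.
have d0 : d != 0 by apply: denom_ratioP.
set g := gcdp n d; have g0 : g != 0 by rewrite gcdp_eq0 negb_and d0 orbT.
set n' := (n %/ g)%R; set d' := (d %/ g)%R.
have nE : n = n' * g by rewrite divpK // dvdp_gcdl.
have dE : d = d' * g by rewrite divpK // dvdp_gcdr.
have E' : n' * f2 = f1 * d'.
  by apply: (mulIf g0); rewrite mulrAC -nE E dE mulrA.
have cop : coprimep d' n'.
  by rewrite coprimep_sym coprimep_div_gcd // d0 orbT.
have /dvdpP[h f2E] : d' %| f2.
  by rewrite -(Gauss_dvdpr _ cop) E' dvdp_mull.
have d'0 : d' != 0 by apply: contraNneq d0 => h0; rewrite dE h0 mul0r.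
have f1E : f1 = h * n'.
  by apply: (mulIf d'0); rewrite -E' f2E; ring.
move: f2z; rewrite f2E f1E !rmorphM !hornerM mulf_eq0 negb_or => /andP[hz dz].
by rewrite (negPf dz); congr Some; field; rewrite hz dz.
Qed.

Lemma ratfun_map_galois (s : {rmorphism L -> L}) h (z : option L) :
  (forall x, s (iota x) = iota x) ->
  ratfun_map iota h (omap s z) = omap s (ratfun_map iota h z).
Proof.
move=> sK; rewrite /ratfun_map.
have mapE p y : (map_poly iota p).[s y] = s (map_poly iota p).[y].
  rewrite -horner_map; congr (_.[_]); apply/polyP => i.
  by rewrite !coef_map /= sK.
case: z => [y|] /=; last first.
  by case: ifP => //= _; rewrite lead_coef_map !coef_map /= -fmorph_div sK.
by rewrite !mapE fmorph_eq0; case: ifP => //= _; rewrite fmorph_div.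
Qed.

End RationalFunctionMap.

Section SeparablyClosed.
Variable L : fieldType.
Hypothesis Lclosed : separably_closed L.

Lemma separable_split (p : {poly L}) : separable_poly p ->
  exists rs : seq L, p %= \prod_(x <- rs) ('X - x%:P).
Proof.
move: {2}(size p) (leqnn (size p)) => n; elim: n p => [|n IH] p pn ps.
  move: pn; rewrite leqn0 size_poly_eq0 => /eqP p0.
  by have := separable_poly_neq0 ps; rewrite p0 eqxx.
have [p1|p1] := leqP (size p) 1.
  exists [::]; rewrite big_nil; have p0 := separable_poly_neq0 ps.
  by rewrite -size_poly_eq1 eqn_leq p1 size_poly_gt0.
have [y /factor_theorem[q pE]] := Lclosed ps p1.
have qs : separable_poly q by move: ps; rewrite pE separable_mul => /and3P[].
have [|rs qE] := IH q _ qs.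
  move: pn; rewrite pE size_Mmonic ?monicXsubC ?separable_poly_neq0 //.
  by rewrite size_XsubC addn2.
by exists (y :: rs); rewrite big_cons pE mulrC eqp_mul2l // polyXsubC_eq0.
Qed.

(** The combination x * p' - e * p of p = x ^ e - c and its derivative is the
    nonzero constant e * c. *)
Lemma separable_XnsubC (e : nat) (c : L) : e%:R != 0 :> L -> c != 0 ->
  separable_poly ('X^e - c%:P).
Proof.
move=> e0 c0; have ep : (0 < e)%N by case: e e0 => //; rewrite eqxx.
rewrite unlock /separable_poly; apply/Bezout_coprimepP.
(* The Bezout coefficients of the constant e * c. *)
exists (- e%:R, 'X); rewrite derivB derivXn derivC subr0 /=.
set u := (X in X %= 1); have -> : u = (e%:R * c)%:P.
  rewrite /u mulrnAr -exprS prednK // polyCM polyC_natr -[X in _ + X]mulr_natl; ring.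
by rewrite -size_poly_eq1 size_polyC mulf_neq0.
Qed.

Lemma card_seq (T : choiceType) (x0 : T) (s : seq T) : uniq s ->
  ([set` s] #= `I_(size s))%card.
Proof.
move=> sU; apply/card_set_bijP; exists (fun x => index x s); split.
- by move=> x /=; rewrite index_mem.
- by move=> x y /set_mem xs /set_mem ys; apply: index_inj.
- by move=> i /= ilt; exists (nth x0 s i); [exact: mem_nth|exact: index_uniq].
Qed.

Lemma nth_roots_card (e : nat) (c : L) : e%:R != 0 :> L -> c != 0 ->
  ([set y : L | y ^+ e = c] #= `I_e)%card.
Proof.
move=> e0 c0; have ep : (0 < e)%N by case: e e0 => //; rewrite eqxx.
have ps := separable_XnsubC e0 c0.
have [rs rsE] := separable_split ps.
have rsU : uniq rs by rewrite -separable_prod_XsubC -(eqp_separable rsE).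
have -> : [set y : L | y ^+ e = c] = [set` rs].
  by apply/seteqP; split=> y /=;
    rewrite -root_prod_XsubC -(eqp_root rsE) rootE !hornerE subr_eq0 => /eqP.
have <- : size rs = e.
  by apply: succn_inj; rewrite -(size_prod_XsubC rs id) -(eqp_size rsE) size_XnsubC.
exact: card_seq 0 rs rsU.
Qed.
End SeparablyClosed.

(** * The tree of preimages outside the unit disc *)

Lemma image_stable (W : Type) (f : W -> W) (A : set W) :
  (forall w, exists w', f w' = w) -> (forall w, A (f w) <-> A w) -> f @` A = A.
Proof.
move=> surj fA; apply/seteqP; split=> [_ [w Aw <-]|w Aw]; first by apply/fA.
by have [w' w'E] := surj w; exists w' => //; apply/fA; rewrite w'E.
Qed.

(** It is enough that the same intermediate fields contain A and B. *)
Lemma generated_field_eq (K L : fieldType) (iota : {rmorphism K -> L}) (A B : set L) :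
  (forall M, intermediate_field iota M -> A `<=` M <-> B `<=` M) ->
  generated_field iota A = generated_field iota B.
Proof.
move=> h; apply/seteqP.
by split=> x hx M [MF MS]; apply: hx; split=> //; apply/(h _ MF).
Qed.

Section BoettcherTree.
Variables (R : realType) (K : fieldType) (abs : K -> R).
Variables (L : fieldType) (iota : {rmorphism K -> L}) (absL : L -> R).
Hypotheses (absP : nonarch_absval abs) (Kcomplete : abs_complete abs).
Hypotheses (LsepK : separable_closure iota) (absLP : nonarch_absval absL).
Hypothesis absLK : forall x : K, absL (iota x) = abs x.
Variables (e : nat) (f1 f2 : {poly K}) (b : nat -> K).
Hypotheses (e2 : (1 < e)%N) (eL : e%:R != 0 :> L).
Hypotheses (f1i : f1 \is a polyOver (integer_ring abs)) (f1m : f1 \is monic).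
Hypotheses (f2i : f2 \is a polyOver (integer_ring abs)) (f2m : f2 \is monic).
Hypothesis hdeg : (size f1).-1 = ((size f2).-1 + e)%N.
Hypothesis bP : is_boettcher abs f1 f2 e b.

Local Notation bK := (boettcher_eval abs idfun b).
Local Notation bL := (boettcher_eval absL iota b).
Local Notation phi := (FracField.tofrac f1 / FracField.tofrac f2).
Local Notation xe := (FracField.tofrac ('X^e : {poly K})).

Definition phi_eval (z : L) : L := (map_poly iota f1).[z] / (map_poly iota f2).[z].

Lemma algebraicL (x : L) : exists2 q : {poly K}, q != 0 & root (map_poly iota q) x.
Proof.
case: LsepK => /(_ x)[q qs qx] _; exists q => //; exact: separable_poly_neq0.
Qed.

Let b1 : integral_coefs abs b. Proof. by case: bP. Qed.
Let e0 : (0 < e)%N. Proof. exact: ltnW. Qed.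

Lemma denominator_neq0 z : 1 < absL z -> (map_poly iota f2).[z] != 0.
Proof. exact: (horner_monic_neq0 absP absLP absLK). Qed.

(** In particular phi maps the outside of the unit disc to itself, so its
    iterates never leave it. *)
Lemma phi_eval_abs z : 1 < absL z -> absL (phi_eval z) = absL z ^+ e.
Proof.
move=> z1; rewrite absM // absV // !(abs_horner_monic absP absLP absLK) //.
by rewrite hdeg exprD mulrAC divff ?mul1r // expf_neq0 // gt_eqF // (lt_trans _ z1).
Qed.

Lemma phi_eval_gt1 z : 1 < absL z -> 1 < absL (phi_eval z).
Proof. by move=> z1; rewrite phi_eval_abs // exprn_egt1 // -lt0n. Qed.

Lemma boettcher_conjugates z : 1 < absL z -> bL (phi_eval z) = bL z ^+ e.
Proof.
move=> z1.
have zc : complete_in absL (adjoin iota z) by exact: (adjoin_complete absP Kcomplete algebraicL).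
have [_ hz] := boettcher_tail absP absLP absLK Kcomplete algebraicL b1 z1.
have [_ hp] := boettcher_tail absP absLP absLK Kcomplete algebraicL b1 (phi_eval_gt1 z1).
have := boettcher_functional_equation absP absLP absLK f1i f1m f2i f2m e0 hdeg bP
  (adjoin_field algebraicL z) zc (adjoin_id iota z) z1 _ hz hp.
by rewrite divfK ?denominator_neq0 // !subrKC => ->.
Qed.

Lemma ratfun_map_phi z : 1 < absL z ->
  ratfun_map iota phi (Some z) = Some (phi_eval z).
Proof. by move=> z1; apply/ratfun_mapE/denominator_neq0. Qed.

Lemma ratfun_map_power y : ratfun_map iota xe (Some y) = Some (y ^+ e).
Proof.
(* The denominator 1 brings the power map under ratfun_mapE. *)
have -> : xe = FracField.tofrac 'X^e / FracField.tofrac 1 by rewrite tofrac1 divr1.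
by rewrite ratfun_mapE rmorph1 hornerC ?oner_eq0 // divr1 map_polyXn hornerXn.
Qed.

(* The facts about the map b under the standing hypotheses of this section. *)
Local Notation boettcher_inj := (boettcher_inj absP absLP absLK Kcomplete algebraicL b1).
Local Notation boettcher_abs := (boettcher_abs absP absLP absLK Kcomplete algebraicL b1).
Local Notation boettcher_surj := (boettcher_surj absP absLP absLK Kcomplete algebraicL b1).
Local Notation boettcher_galois := (boettcher_galois absP absLP absLK Kcomplete algebraicL b1).
Local Notation galois_absE := (galois_absE absP absLP absLK Kcomplete algebraicL).
Local Notation boettcher_base := (boettcher_base absP absLP absLK Kcomplete b1).

(** Roots of elements outside the disc lie outside: this is why the condition
    |y| > 1 appears on the side of phi only. *)
Lemma root_gt1 (n : nat) y : 1 < absL (y ^+ n) -> 1 < absL y.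
Proof.
rewrite absX // !ltNge; apply: contra => y1.
by rewrite exprn_ile1 // abs_ge0.
Qed.

Definition outer_preimages (gamma : L) : set L :=
  [set y | 1 < absL y /\ ratfun_map iota phi (Some y) = Some gamma].

(** Surjectivity: an e-th root w of b(gamma) is b(z) for some z with |z| > 1, and
    b(phi(z)) = w ^ e = b(gamma) gives phi(z) = gamma by injectivity. *)
Lemma outer_preimages_bij gamma : 1 < absL gamma ->
  set_bij (outer_preimages gamma) [set y | y ^+ e = bL gamma] bL.
Proof.
move=> g1; split.
- move=> y [y1]; rewrite ratfun_map_phi // => -[<-] /=.
  by rewrite boettcher_conjugates.
- by move=> y z /set_mem[y1 _] /set_mem[z1 _]; apply: boettcher_inj.
- move=> w /= we.
  have w1 : 1 < absL w by apply: (@root_gt1 e); rewrite we boettcher_abs.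
  have [z [z1 zw _]] := boettcher_surj w1; exists z => //; split=> //.
  rewrite ratfun_map_phi //; congr Some; apply: boettcher_inj => //.
    exact: phi_eval_gt1.
  by rewrite boettcher_conjugates // zw.
Qed.

Lemma galois_surj s (y : L) : galois_aut iota s -> exists y', s y' = y.
Proof. by move=> [[g sg gs] _]; exists (g y). Qed.

Lemma ratfun_map_galois_iff s h x y : galois_aut iota s ->
  ratfun_map iota h (Some (s y)) = Some (s x) <-> ratfun_map iota h (Some y) = Some x.
Proof.
move=> [_ sK]; rewrite (ratfun_map_galois h (Some y) sK); case: (ratfun_map _ _ _) => [z|] //=.
by split=> [[/fmorph_inj ->]|[->]].
Qed.

Lemma outer_preimages_galois_iso gamma : 1 < abs gamma ->
  galois_set_iso iota (fun s y => s y) (outer_preimages (iota gamma))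
    [set y | y ^+ e = iota (bK gamma)] bL.
Proof.
move=> g1; have ig1 : 1 < absL (iota gamma) by rewrite absLK.
split.
- move=> s sG; apply: image_stable => y; first exact: galois_surj.
  rewrite /outer_preimages /= galois_absE // -{1}(sG.2 gamma).
  by rewrite ratfun_map_galois_iff.
- move=> s sG; apply: image_stable => y; first exact: galois_surj.
  by rewrite /= -rmorphXn -{1}sG.2; split=> [/fmorph_inj|->].
- by rewrite -boettcher_base //; apply: outer_preimages_bij.
- by move=> s sG y [y1 _]; apply: boettcher_galois.
Qed.

Lemma iter_phi n y : 1 < absL y ->
  iter n (ratfun_map iota phi) (Some y) = Some (iter n phi_eval y).
Proof.
(* The induction needs that the iterates stay outside the disc. *)
move=> y1; suff: iter n (ratfun_map iota phi) (Some y) = Some (iter n phi_eval y)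
  /\ 1 < absL (iter n phi_eval y) by case.
elim: n => [|n [IH1 IH2]] //=.
by rewrite IH1 ratfun_map_phi //; split=> //; apply: phi_eval_gt1.
Qed.

Lemma iter_phi_gt1 n y : 1 < absL y -> 1 < absL (iter n phi_eval y).
Proof. by move=> y1; elim: n => //= n; apply: phi_eval_gt1. Qed.

Lemma iter_power n y :
  iter n (ratfun_map iota xe) (Some y) = Some (y ^+ (e ^ n)).
Proof. by elim: n => [|n IH] //=; rewrite IH ratfun_map_power -exprM expnSr. Qed.

Lemma boettcher_iter n y : 1 < absL y -> bL (iter n phi_eval y) = bL y ^+ (e ^ n).
Proof.
move=> y1; elim: n => [|n IH] //=.
by rewrite boettcher_conjugates ?IH -?exprM ?expnSr //; apply: iter_phi_gt1.
Qed.

Variable alpha : K.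
Hypothesis alpha1 : 1 < abs alpha.

Let ialpha1 : 1 < absL (iota alpha). Proof. by rewrite absLK. Qed.

Local Notation Te := (T_infty_e iota absL phi alpha).
Local Notation Txe := (T_infty iota xe (bK alpha)).

(** Membership in the tree in terms of a genuine self-map of the outside of the
    disc, without the point at infinity. *)
Lemma TeE v : Te v <-> 1 < absL v.2 /\ iter v.1 phi_eval v.2 = iota alpha.
Proof.
rewrite /T_infty_e /T_infty /=; split=> [[h v1]|[v1 h]].
  by move: h; rewrite iter_phi // => -[].
by split=> //; rewrite iter_phi // h.
Qed.

Lemma TxeE v : Txe v <-> v.2 ^+ (e ^ v.1) = bL (iota alpha).
Proof.
by rewrite /T_infty /= iter_power boettcher_base //; split=> [[]|->].
Qed.

Lemma Te_boettcher n y : 1 < absL y -> Te (n, y) <-> Txe (n, bL y).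
Proof.
move=> y1; rewrite TeE TxeE /= -boettcher_iter //; split=> [[_ ->]|h] //.
by split=> //; apply: boettcher_inj => //; apply: iter_phi_gt1.
Qed.

Lemma Txe_gt1 w : Txe w -> 1 < absL w.2.
Proof.
by move=> /TxeE we; apply: (@root_gt1 (e ^ w.1)); rewrite we boettcher_abs.
Qed.

Definition phi_parent (v : nat * L) : nat * L := (v.1.-1, phi_eval v.2).

Lemma ascendsE v w : Te w -> ascends iota phi w v <-> child fst phi_parent v w.
Proof.
move=> /TeE[w1 _]; rewrite /ascends /child /phi_parent ratfun_map_phi //.
case: v w w1 => n y [m z] /= z1; split=> [[-> [->]]|[-> [<-]]] //.
Qed.

Lemma Te_regular : regular_rooted_tree fst e Te (T_adj iota phi) (0%N, iota alpha).
Proof.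
have Tr : Te (0%N, iota alpha) by apply/TeE.
split=> //.
  apply: (@levelled_is_tree _ fst _ _ phi_parent (0%N, iota alpha)) => //.
  - by move=> [n y] /TeE[/= _ h] n0; rewrite n0 /= in h *; rewrite h.
  - move=> [[|n] y] // /TeE[/= y1 h] _; split; last by [].
    by apply/TeE; rewrite /= -iterSr; split=> //; apply: phi_eval_gt1.
  - move=> v w Vv Vw; rewrite /T_adj (ascendsE _ Vw) (ascendsE _ Vv).
    by split=> -[]; auto.
move=> [n y] /[dup] Vv /TeE[/= y1 yE].
pose D := descendants fst Te (T_adj iota phi) (n, y).
have DE w : D w <-> w.1 = n.+1 /\ outer_preimages y w.2.
  split=> [[Vw vw /= lw]|[lw [w1 wy]]].
    split=> //; split; first by case/TeE: Vw.
    case: vw => [[/= h _]|[]] //.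
    by rewrite lw in h; lia.
  split=> //; last by right.
  apply/TeE; split=> //; rewrite lw iterSr.
  by move: wy; rewrite ratfun_map_phi // => -[->].
have [bfun binj bsurj] := outer_preimages_bij y1.
have Dinj : {in D &, injective (fun w => bL w.2)}.
  move=> [m z] [m' z'] /set_mem/DE[/= -> hz] /set_mem/DE[/= -> hz'] h.
  by congr pair; apply: binj; rewrite ?inE.
have Dim : (fun w => bL w.2) @` D = [set x | x ^+ e = bL y].
  apply/seteqP; split=> [_ [w /DE[_ wy] <-]|x /bsurj[z yz <-]]; first exact: bfun.
  by exists (n.+1, z) => //; apply/DE.
have := inj_card_eq Dinj; rewrite Dim card_eq_sym => h.
apply: card_eq_trans h _; apply: nth_roots_card => //; first by case: LsepK.
by apply: (abs_gt1_neq0 absLP); rewrite boettcher_abs.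
Qed.

Lemma T_act_surj s (v : nat * L) : galois_aut iota s -> exists v', T_act s v' = v.
Proof.
by case: v => n y sG; have [y' <-] := galois_surj y sG; exists (n, y').
Qed.

Lemma T_infty_galois s h a v : galois_aut iota s ->
  T_infty iota h a (T_act s v) <-> T_infty iota h a v.
Proof.
move=> sG; case: v => n y; rewrite /T_infty /T_act /=.
have -> : iter n (ratfun_map iota h) (Some (s y))
    = omap s (iter n (ratfun_map iota h) (Some y)).
  by elim: n => //= n ->; apply: ratfun_map_galois; case: sG.
case: (iter _ _ _) => [z|] //=; split=> -[]; last by move=> ->; rewrite sG.2.
by rewrite -{1}(sG.2 a) => /fmorph_inj ->.
Qed.

Lemma Te_galois s v : galois_aut iota s -> Te (T_act s v) <-> Te v.
Proof.
move=> sG; have h := T_infty_galois phi alpha v sG.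
by rewrite /T_infty_e /= galois_absE //; split=> -[/h].
Qed.

Lemma T_adj_galois s h v w : galois_aut iota s ->
  T_adj iota h v w <-> T_adj iota h (T_act s v) (T_act s w).
Proof.
move=> sG; have E := ratfun_map_galois_iff h _ _ sG.
by rewrite /T_adj /ascends /= !E.
Qed.

Lemma ascends_boettcher v w : Te v -> Te w ->
  ascends iota phi w v <-> ascends iota xe (w.1, bL w.2) (v.1, bL v.2).
Proof.
move=> /TeE[v1 _] /TeE[w1 _]; rewrite /ascends ratfun_map_phi // ratfun_map_power.
rewrite -boettcher_conjugates //=; split=> -[-> [h]]; split=> //; first by rewrite h.
by congr Some; apply: boettcher_inj => //; apply: phi_eval_gt1.
Qed.

Lemma Te_boettcher_bij : set_bij Te Txe (fun v => (v.1, bL v.2)).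
Proof.
split.
- by move=> [n y] /= /[dup] /TeE[/= y1 _]; rewrite (Te_boettcher n y1).
- move=> [n y] [m z] /set_mem/TeE[/= y1 _] /set_mem/TeE[/= z1 _] [-> h].
  by congr pair; apply: boettcher_inj.
- move=> [n w] /[dup] Tw /Txe_gt1 /= w1; have [z [z1 zw _]] := boettcher_surj w1.
  by exists (n, z); rewrite /= ?zw //; apply/Te_boettcher; rewrite ?zw.
Qed.

Lemma Te_tree_iso : galois_tree_iso iota Te (T_adj iota phi) (0%N, iota alpha)
  Txe (T_adj iota xe) (0%N, iota (bK alpha)) (fun v => (v.1, bL v.2)).
Proof.
split=> //=; last first.
- move=> v w Tv Tw; rewrite /T_adj.
  by rewrite (ascends_boettcher Tv Tw) (ascends_boettcher Tw Tv).
- by rewrite boettcher_base.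
split.
- move=> s sG; apply: image_stable => v; [exact: T_act_surj|exact: Te_galois].
- move=> s sG; apply: image_stable => v; [exact: T_act_surj|exact: T_infty_galois].
- exact: Te_boettcher_bij.
- move=> s sG [n y] /TeE[/= y1 _]; rewrite /T_act /=.
  by rewrite boettcher_galois.
Qed.

(** A field containing z contains K(z), hence b(z); a field containing b(z)
    contains K(b(z)), hence z. *)
Lemma Te_generated_field : generated_field iota (vertex_points Te)
  = generated_field iota (vertex_points Txe).
Proof.
apply: generated_field_eq => M MF; split=> sub _ [[n y] Ty <-] /=.
  have [z [z1 zy _]] := boettcher_surj (Txe_gt1 Ty); rewrite /= in zy.
  have Mz : M z by apply: sub; exists (n, z) => //; apply/Te_boettcher; rewrite ?zy.
  rewrite -zy; apply: (adjoin_sub MF Mz).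
  exact: (boettcher_adjoin absP absLP absLK Kcomplete algebraicL b1).
have [/= y1 _] := (TeE _).1 Ty.
have My : M (bL y) by apply: sub; exists (n, bL y) => //; apply/Te_boettcher.
have bLy1 : 1 < absL (bL y) by rewrite boettcher_abs.
have [z [z1 /boettcher_inj -> // yz]] := boettcher_surj bLy1.
exact: (adjoin_sub MF My).
Qed.

End BoettcherTree.

Theorem proposition4p11
  (R : realType)
  (K : fieldType) (abs : K -> R) (hK : local_field abs)
  (L : fieldType) (iota : {rmorphism K -> L}) (hL : separable_closure iota)
  (absL : L -> R) (habsL : nonarch_absval absL)
  (hext : forall x : K, absL (iota x) = abs x)
  (e : nat) (he : (2 <= e)%N)
  (heinv : exists2 y : K, y \in integer_ring abs & e%:R * y = 1)
  (phi : {fraction {poly K}}) (f1 f2 : {poly K})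
  (hphi : phi = FracField.tofrac f1 / FracField.tofrac f2)
  (hf1 : f1 \is a polyOver (integer_ring abs))
  (hf2 : f2 \is a polyOver (integer_ring abs))
  (hf1m : f1 \is monic) (hf2m : f2 \is monic)
  (hdeg : (size f1).-1 = ((size f2).-1 + e)%N)
  (b : nat -> K) (hb : is_boettcher abs f1 f2 e b)
  (alpha : K) (halpha : 1 < abs alpha) :
  let bK : K -> K := boettcher_eval abs idfun b in
  let bL : L -> L := boettcher_eval absL iota b in
  let xe : {fraction {poly K}} := FracField.tofrac 'X^e in
  let Te : set (nat * L) := T_infty_e iota absL phi alpha in
  let Txe : set (nat * L) := T_infty iota xe (bK alpha) in
  [/\ forall gamma : K, 1 < abs gamma ->
        galois_set_iso iota (fun s y => s y)
          [set y : L | 1 < absL y /\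
                       ratfun_map iota phi (Some y) = Some (iota gamma)]
          [set y : L | y ^+ e = iota (bK gamma)]
          bL,
      regular_rooted_tree fst e Te (T_adj iota phi) (0%N, iota alpha) /\
      (forall s : {rmorphism L -> L}, galois_aut iota s ->
         T_act s @` Te = Te /\
         forall v w, Te v -> Te w ->
           (T_adj iota phi v w <-> T_adj iota phi (T_act s v) (T_act s w))) &
      galois_tree_iso iota
        Te (T_adj iota phi) (0%N, iota alpha)
        Txe (T_adj iota xe) (0%N, iota (bK alpha))
        (fun v => (v.1, bL v.2)) /\
      generated_field iota (vertex_points Te)
        = generated_field iota (vertex_points Txe)].
Proof.
move=> bK bL xe Te Txe; rewrite {}/Te {phi}hphi.
have [absP Kcomplete] := local_field_complete hK.
have eL : e%:R != 0 :> L.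
  case: heinv => y _ ey; rewrite -(rmorph_nat iota) fmorph_eq0.
  by apply: contra_eq_neq ey => ->; rewrite mul0r eq_sym oner_neq0.
split.
- move=> gamma g1; apply: outer_preimages_galois_iso => //.
- split; first exact: (Te_regular absP Kcomplete hL habsL hext he eL hf1 hf1m hf2 hf2m hdeg hb).
  move=> s sG; split; last by move=> v w _ _; apply: T_adj_galois.
  apply: image_stable => v; first exact: T_act_surj sG.
  exact: (Te_galois absP Kcomplete hL habsL hext).
- split; first exact: (Te_tree_iso absP).
  exact: (Te_generated_field absP).
Qed.
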